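(* Let $G$ be a countable group. The minimal faces of $Sof(G,P^\omega)$ are exactly its extreme points: a subset $F\subset Sof(G,P^\omega)$ is a minimal face if and only if $F=\{[\Theta]\}$ for some extreme point $[\Theta]$ of $Sof(G,P^\omega)$.
   Context: Fix a free ultrafilter $\omega$ on $\mathbb{N}$. $M_n$ is the algebra of $n\times n$ complex matrices with normalised trace $Tr(x)=\frac1n\sum_i x(i,i)$, $D_n\subset M_n$ the diagonal matrices, $P_n\subset M_n$ the group of permutation matrices, and for $p,q\in P_n$, $d_H(p,q)=1-Tr(p^{-1}q)$ is the normalised Hamming distance. For natural numbers $n_k$ with $\lim_k n_k=\infty$, $\Pi_{k\to\omega}M_{n_k}$ is the tracial ultraproduct (norm-bounded sequences modulo sequences with $\lim_{k\to\omega}\|x_k\|_2=0$, $\|x\|_2^2=Tr(x^*x)$), with trace $Tr(\Pi_{k\to\omega}x_k)=\lim_{k\to\omega}Tr(x_k)$; $\Pi_{k\to\omega}P_{n_k}$ and $\Pi_{k\to\omega}D_{n_k}$ are the subsets of elements represented by sequences in $P_{n_k}$, respectively $D_{n_k}$. A sofic representation of $G$ is a group homomorphism $\Theta:G\to\Pi_{k\to\omega}P_{n_k}$ with $Tr(\Theta(g))=0$ for all $g\neq 1_G$. Its amplification by positive integers $(r_k)_k$ is $\Theta\otimes Id_{r_k}:G\to\Pi_{k\to\omega}P_{n_kr_k}$. Two sofic representations $\Theta:G\to\Pi_{k\to\omega}P_{n_k}$ and $\Psi:G\to\Pi_{k\to\omega}P_{m_k}$ are equivalent if there are positive integers $r_k,t_k$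 with $n_kr_k=m_kt_k$ such that $\Theta\otimes Id_{r_k}$ and $\Psi\otimes Id_{t_k}$ are conjugate by an element of $\Pi_{k\to\omega}P_{n_kr_k}$. $[\Theta]$ is the class of $\Theta$, and $Sof(G,P^\omega)$ is the set of all classes. Convex structure: for $\lambda\in[0,1]$, $\lambda[\Theta]+(1-\lambda)[\Psi]$ is the class of $(\Theta\otimes Id_{r_k})\oplus(\Psi\otimes Id_{t_k})$, where $r_k,t_k$ are positive integers with $\lim_{k\to\omega}\frac{n_kr_k}{n_kr_k+m_kt_k}=\lambda$ (the class is independent of choices). A face is a nonempty convex subset $F\subset Sof(G,P^\omega)$ such that $\lambda[\Psi_1]+(1-\lambda)[\Psi_2]\in F$ with $0<\lambda<1$ implies $[\Psi_1],[\Psi_2]\in F$. A minimal face is a face that contains no strictly smaller face. $[\Theta]$ is an extreme point if $[\Theta]=\lambda[\Psi_1]+(1-\lambda)[\Psi_2]$ with $0<\lambda<1$ implies $[\Psi_1]=[\Psi_2]=[\Theta]$. *)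

(* Defs.v *)
From HB Require Import structures.
From mathcomp Require Import all_boot all_order all_algebra perm.
From mathcomp Require Import complex mxtens.
From mathcomp Require Import all_classical all_reals all_analysis.
Import Order.TTheory GRing.Theory Num.Theory.
Import numFieldNormedType.Exports.

Set Implicit Arguments.
Unset Strict Implicit.
Unset Printing Implicit Defensive.

Local Open Scope classical_set_scope.
Local Open Scope ring_scope.
Local Open Scope sesquilinear_scope.
Local Open Scope quotient_scope.

Section Matrices.
Variable C : numClosedFieldType.

Definition ntr n (A : 'M[C]_n) : C := \tr A / n%:R.

(* Frobenius norm; on a column vector it is the Euclidean norm. *)
Definition fnorm m n (A : 'M[C]_(m, n)) : C := sqrtC (\tr (A^t* *m A)).

Definition norm2 n (A : 'M[C]_n) : C := sqrtC (ntr (A^t* *m A)).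

Definition opnorm_le n (A : 'M[C]_n) (c : C) : Prop :=
  forall v : 'cV[C]_n, fnorm (A *m v) <= c * fnorm v.

Lemma fnorm2E m n (A : 'M[C]_(m, n)) :
  \tr (A^t* *m A) = \sum_i \sum_j `|A i j| ^+ 2.
Proof.
rewrite exchange_big; apply: eq_bigr => j _ /=; rewrite mxE.
by apply: eq_bigr => i _; rewrite !mxE mulrC -normCK.
Qed.

Lemma fdotE m n (A B : 'M[C]_(m, n)) :
  \tr (A *m B^t*) = dotmx (mxvec A) (mxvec B).
Proof.
rewrite dotmxE mxE (reindex _ (curry_mxvec_bij m n)) /=.
transitivity (\sum_i \sum_j A i j * (B i j)^*).
  by apply: eq_bigr => i _; rewrite mxE; apply: eq_bigr => j _; rewrite !mxE.
rewrite pair_bigA; apply: eq_bigr => -[i j] _ /=.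
by rewrite mxE !mxvecE mxE mxvecE.
Qed.

Lemma fnormE m n (A : 'M[C]_(m, n)) :
  fnorm A = sqrtC (dotmx (mxvec A) (mxvec A)).
Proof. by rewrite /fnorm mxtrace_mulC fdotE. Qed.

Lemma tr_ge0 m n (A : 'M[C]_(m, n)) : 0 <= \tr (A^t* *m A).
Proof.
by rewrite fnorm2E; do 2! apply: sumr_ge0 => ? _; rewrite exprn_ge0.
Qed.

Lemma fnorm_ge0 m n (A : 'M[C]_(m, n)) : 0 <= fnorm A.
Proof. by rewrite sqrtC_ge0 tr_ge0. Qed.

Lemma fnorm_sqr m n (A : 'M[C]_(m, n)) :
  fnorm A ^+ 2 = \sum_i \sum_j `|A i j| ^+ 2.
Proof. by rewrite /fnorm sqrtCK fnorm2E. Qed.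

Lemma fnorm_sqr_le m n p q (A : 'M[C]_(m, n)) (B : 'M[C]_(p, q)) c :
  0 <= c -> (fnorm A <= c * fnorm B) = (fnorm A ^+ 2 <= c ^+ 2 * fnorm B ^+ 2).
Proof.
by move=> c0; rewrite -exprMn ler_sqr // nnegrE ?mulr_ge0 ?fnorm_ge0.
Qed.

Lemma fnormD m n (A B : 'M[C]_(m, n)) : fnorm (A + B) <= fnorm A + fnorm B.
Proof.
rewrite !fnormE linearD /=.
exact: (triangle_lerif (@dotmx C _) (mxvec A) (mxvec B)).1.
Qed.

Lemma CS_tr m n (A B : 'M[C]_(m, n)) :
  `|\tr (A *m B^t*)| <= fnorm A * fnorm B.
Proof.
rewrite fdotE !fnormE.
exact: (CauchySchwarz_sqrt (@dotmx C _) (mxvec A) (mxvec B)).1.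
Qed.

Lemma adjmxM m n p (A : 'M[C]_(m, n)) (B : 'M[C]_(n, p)) :
  (A *m B)^t* = B^t* *m A^t*.
Proof. by rewrite trmx_mul map_mxM. Qed.

Lemma adjmxB m n (A B : 'M[C]_(m, n)) : (A - B)^t* = A^t* - B^t*.
Proof. by rewrite linearB /= map_mxB. Qed.

Lemma fnorm_adj m n (A : 'M[C]_(m, n)) : fnorm (A^t*) = fnorm A.
Proof. by rewrite /fnorm trmxCK mxtrace_mulC. Qed.

Lemma fnormN m n (A : 'M[C]_(m, n)) : fnorm (- A) = fnorm A.
Proof.
apply: (congr1 sqrtC); rewrite !fnorm2E.
by apply: eq_bigr => i _; apply: eq_bigr => j _; rewrite mxE normrN.
Qed.

Lemma norm2E n (A : 'M[C]_n) : norm2 A = fnorm A / sqrtC n%:R.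
Proof.
rewrite /norm2 /ntr sqrtCM ?nnegrE ?tr_ge0 ?invr_ge0 ?ler0n //.
by rewrite rootCV ?ler0n.
Qed.

Lemma norm2_ge0 n (A : 'M[C]_n) : 0 <= norm2 A.
Proof. by rewrite norm2E divr_ge0 ?fnorm_ge0 ?sqrtC_ge0 ?ler0n. Qed.

Lemma norm2D n (A B : 'M[C]_n) : norm2 (A + B) <= norm2 A + norm2 B.
Proof. by rewrite !norm2E -mulrDl ler_wpM2r ?fnormD. Qed.

Lemma norm2N n (A : 'M[C]_n) : norm2 (- A) = norm2 A.
Proof. by rewrite !norm2E fnormN. Qed.

Lemma norm2_adj n (A : 'M[C]_n) : norm2 (A^t*) = norm2 A.
Proof. by rewrite !norm2E fnorm_adj. Qed.

Lemma norm20 n : norm2 (0 : 'M[C]_n) = 0.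
Proof. by rewrite /norm2 /ntr mulmx0 mxtrace0 mul0r sqrtC0. Qed.

Lemma ntrB n (A B : 'M[C]_n) : ntr (A - B) = ntr A - ntr B.
Proof. by rewrite /ntr linearB /= mulrBl. Qed.

Lemma ntr_le n (A : 'M[C]_n) : `|ntr A| <= norm2 A.
Proof.
have [n0|n0] := posnP n.
  by rewrite /ntr {2}n0 invr0 mulr0 normr0 norm2_ge0.
have nC : (0 : C) < n%:R by rewrite ltr0n.
have := CS_tr A 1%:M.
rewrite trmx1 map_mx1 mulmx1 norm2E.
have -> : fnorm (1%:M : 'M[C]_n) = sqrtC n%:R.
  by rewrite /fnorm mulmx1 trmx1 map_mx1 mxtrace1.
move=> h; rewrite /ntr normrM normfV normr_nat ler_pdivrMr //.
rewrite -{2}(sqrtCK n%:R) expr2 -mulrA mulKf //.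
by rewrite sqrtC_eq0 gt_eqF.
Qed.

Lemma fnorm_col m n (A : 'M[C]_(m, n)) :
  fnorm A ^+ 2 = \sum_j fnorm (col j A) ^+ 2.
Proof.
rewrite fnorm_sqr exchange_big; apply: eq_bigr => j _ /=.
rewrite fnorm_sqr; apply: eq_bigr => i _.
by rewrite big_ord1 mxE.
Qed.

Lemma opnorm_leM n p (A : 'M[C]_n) c (B : 'M[C]_(n, p)) :
  0 <= c -> opnorm_le A c -> fnorm (A *m B) <= c * fnorm B.
Proof.
move=> c0 Ac; rewrite fnorm_sqr_le // !fnorm_col mulr_sumr.
apply: ler_sum => j _; rewrite -fnorm_sqr_le //.
by rewrite colE -mulmxA -colE.
Qed.

Lemma opnorm_le_adj n (A : 'M[C]_n) c :
  0 <= c -> opnorm_le A c -> opnorm_le (A^t*) c.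
Proof.
move=> c0 Ac v; set w := A^t* *m v.
have wE : fnorm w ^+ 2 = \tr (A *m w *m v^t*).
  by rewrite /fnorm sqrtCK {1}/w adjmxM trmxCK -mulmxA mxtrace_mulC.
have h : fnorm w ^+ 2 <= fnorm w * (c * fnorm v).
  rewrite wE -[leLHS]ger0_norm -?wE ?exprn_ge0 ?fnorm_ge0 // wE.
  apply: le_trans (CS_tr _ _) _; rewrite mulrCA mulrA.
  by rewrite ler_wpM2r ?fnorm_ge0 // Ac.
have := fnorm_ge0 w; rewrite le_eqVlt => /predU1P [<-|w0].
  by rewrite mulr_ge0 ?fnorm_ge0.
by move: h; rewrite expr2 ler_pM2l.
Qed.

Lemma opnorm_leMr n p (A : 'M[C]_n) c (B : 'M[C]_(p, n)) :
  0 <= c -> opnorm_le A c -> fnorm (B *m A) <= c * fnorm B.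
Proof.
move=> c0 /(opnorm_le_adj c0) Ac.
by rewrite -fnorm_adj adjmxM -(fnorm_adj B); apply: opnorm_leM.
Qed.

Lemma norm2Ml n (A B : 'M[C]_n) c :
  0 <= c -> opnorm_le A c -> norm2 (A *m B) <= c * norm2 B.
Proof.
by move=> c0 Ac; rewrite !norm2E mulrA ler_wpM2r ?opnorm_leM.
Qed.

Lemma norm2Mr n (A B : 'M[C]_n) c :
  0 <= c -> opnorm_le A c -> norm2 (B *m A) <= c * norm2 B.
Proof.
by move=> c0 Ac; rewrite !norm2E mulrA ler_wpM2r ?opnorm_leMr.
Qed.

Lemma ntr_le_opnorm n (A : 'M[C]_n) c :
  0 <= c -> opnorm_le A c -> `|ntr A| <= c.
Proof.
move=> c0 Ac; apply: le_trans (ntr_le A) _.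
rewrite -[A]mulmx1; apply: le_trans (norm2Ml _ c0 Ac) _.
rewrite ler_piMr // /norm2 mulmx1 trmx1 map_mx1 /ntr mxtrace1.
case: n {A Ac} => [|n]; first by rewrite mul0r sqrtC0.
by rewrite divff ?sqrtC1 // pnatr_eq0.
Qed.


Lemma sum_mxtens n r (F : 'I_(n * r) -> C) :
  \sum_k F k = \sum_i \sum_j F (mxtens_index (i, j)).
Proof.
rewrite pair_bigA (reindex (@mxtens_index n r)) /=; last first.
  by apply: onW_bij; exists (@mxtens_unindex n r);
    [exact: mxtens_indexK | exact: mxtens_unindexK].
by apply: eq_bigr => -[i j].
Qed.

(* Amplification x |-> x (x) Id_r: a Kronecker product, of size n * r. *)
Definition mxamp r n (A : 'M[C]_n) : 'M[C]_(n * r) := A *t (1%:M : 'M[C]_r).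

Lemma mxampM r n (A B : 'M[C]_n) : mxamp r (A *m B) = mxamp r A *m mxamp r B.
Proof. by rewrite /mxamp tensmx_mul mulmx1. Qed.

Lemma mxampB r n (A B : 'M[C]_n) : mxamp r (A - B) = mxamp r A - mxamp r B.
Proof. by apply/matrixP => i j; rewrite !mxE mulrBl. Qed.

Lemma mxamp_adj r n (A : 'M[C]_n) : (mxamp r A)^t* = mxamp r (A^t*).
Proof. by rewrite /mxamp trmx_tens map_mxT trmx1 map_mx1. Qed.

Lemma mxtrace_amp r n (A : 'M[C]_n) : \tr (mxamp r A) = \tr A * r%:R.
Proof.
rewrite /mxtrace sum_mxtens mulr_suml; apply: eq_bigr => i _.
under eq_bigr do rewrite tensmxE mxE eqxx mulr1.
by rewrite sumr_const card_ord mulr_natr.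
Qed.

Lemma ntr_amp r n (A : 'M[C]_n) : (0 < r)%N -> ntr (mxamp r A) = ntr A.
Proof.
move=> r0; rewrite /ntr mxtrace_amp natrM invfM mulrACA divff ?mulr1 //.
by rewrite pnatr_eq0 -lt0n.
Qed.

Lemma norm2_amp r n (A : 'M[C]_n) : norm2 (mxamp r A) <= norm2 A.
Proof.
case: (posnP r) => [r0|r0]; last first.
  by rewrite /norm2 mxamp_adj -mxampM ntr_amp.
by rewrite {1}/norm2 mxamp_adj -mxampM /ntr mxtrace_amp r0 mulr0 mul0r sqrtC0
  norm2_ge0.
Qed.

Lemma opnorm_le_amp r n (A : 'M[C]_n) c :
  0 <= c -> opnorm_le A c -> opnorm_le (mxamp r A) c.
Proof.
move=> c0 Ac v.
pose V (u : 'cV[C]_(n * r)) : 'M[C]_(n, r) :=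
  \matrix_(i, j) u (mxtens_index (i, j)) 0.
have fV u : fnorm u = fnorm (V u).
  apply: (congr1 sqrtC); rewrite !fnorm2E sum_mxtens.
  by apply: eq_bigr => i _; apply: eq_bigr => j _; rewrite big_ord1 mxE.
have -> : fnorm (mxamp r A *m v) = fnorm (A *m V v).
  rewrite fV; congr fnorm; apply/matrixP => i j; rewrite !mxE sum_mxtens.
  apply: eq_bigr => k _; rewrite (bigD1 j) //= big1 => [|l lj].
    by rewrite tensmxE !mxE eqxx mulr1 addr0.
  by rewrite tensmxE !mxE eq_sym (negbTE lj) mulr0 mul0r.
by rewrite fV; exact: opnorm_leM.
Qed.

Definition mxdsum n m (A : 'M[C]_n) (B : 'M[C]_m) : 'M[C]_(n + m) :=
  block_mx A 0 0 B.

Lemma mxdsumM n m (A A' : 'M[C]_n) (B B' : 'M[C]_m) :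
  mxdsum (A *m A') (B *m B') = mxdsum A B *m mxdsum A' B'.
Proof. by rewrite mulmx_block !mul0mx !mulmx0 !addr0 !add0r. Qed.

Lemma mxdsumB n m (A A' : 'M[C]_n) (B B' : 'M[C]_m) :
  mxdsum (A - A') (B - B') = mxdsum A B - mxdsum A' B'.
Proof. by rewrite /mxdsum opp_block_mx add_block_mx !subr0. Qed.

Lemma mxdsum_adj n m (A : 'M[C]_n) (B : 'M[C]_m) :
  (mxdsum A B)^t* = mxdsum (A^t*) (B^t*).
Proof. by rewrite /mxdsum tr_block_mx map_block_mx !trmx0 !map_mx0. Qed.

Lemma mxtrace_dsum n m (A : 'M[C]_n) (B : 'M[C]_m) :
  \tr (mxdsum A B) = \tr A + \tr B.
Proof. exact: mxtrace_block. Qed.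

Lemma ntr_dsum n m (A : 'M[C]_n) (B : 'M[C]_m) :
  `|ntr (mxdsum A B)| <= `|ntr A| + `|ntr B|.
Proof.
have aux a b (z : C) : z = 0 \/ (0 < a)%N ->
    `|z / (a + b)%:R| <= `|z / a%:R|.
  case=> [->|a0]; first by rewrite !mul0r.
  rewrite !normrM ler_wpM2l // !normfV !normr_nat lef_pV2 ?posrE ?ltr0n ?addn_gt0 ?a0 //.
  by rewrite ler_nat leq_addr.
rewrite /ntr mxtrace_dsum mulrDl; apply: le_trans (ler_normD _ _) _.
apply: lerD; last rewrite addnC; apply: aux.
  by case: n A => [|n] A; [left; rewrite /mxtrace big_ord0 | right].
by case: m B => [|m] B; [left; rewrite /mxtrace big_ord0 | right].
Qed.

Lemma norm2_dsum n m (A : 'M[C]_n) (B : 'M[C]_m) :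
  norm2 (mxdsum A B) <= norm2 A + norm2 B.
Proof.
have e k (D : 'M[C]_k) : norm2 D ^+ 2 = `|ntr (D^t* *m D)|.
  by rewrite sqrtCK ger0_norm // divr_ge0 ?tr_ge0 ?ler0n.
rewrite -ler_sqr ?nnegrE ?addr_ge0 ?norm2_ge0 // e mxdsum_adj -mxdsumM.
apply: le_trans (ntr_dsum _ _) _; rewrite -!e sqrrD addrAC lerDl.
by rewrite mulrn_wge0 ?mulr_ge0 ?norm2_ge0.
Qed.

Lemma opnorm_le_dsum n m (A : 'M[C]_n) (B : 'M[C]_m) c :
  0 <= c -> opnorm_le A c -> opnorm_le B c -> opnorm_le (mxdsum A B) c.
Proof.
move=> c0 Ac Bc v; rewrite -[v]vsubmxK /mxdsum mul_block_col !mul0mx addr0 add0r.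
have fc (a : 'cV[C]_n) (b : 'cV[C]_m) :
    fnorm (col_mx a b) ^+ 2 = fnorm a ^+ 2 + fnorm b ^+ 2.
  rewrite !fnorm_sqr big_split_ord; congr (_ + _); apply: eq_bigr => i _;
    by apply: eq_bigr => j _; rewrite (col_mxEu, col_mxEd).
by rewrite fnorm_sqr_le // !fc mulrDr lerD // -fnorm_sqr_le.
Qed.

Definition mxcast n m (e : n = m) (A : 'M[C]_n) : 'M[C]_m := castmx (e, e) A.

Lemma opnorm_le_cast n m (e : n = m) (A : 'M[C]_n) c :
  opnorm_le A c -> opnorm_le (mxcast e A) c.
Proof. by case: _ / e. Qed.

Lemma norm2_cast n m (e : n = m) (A B : 'M[C]_n) :
  norm2 (mxcast e A - mxcast e B) = norm2 (A - B).
Proof. by case: _ / e. Qed.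

Lemma is_perm_mx_amp r n (A : 'M[C]_n) : is_perm_mx A -> is_perm_mx (mxamp r A).
Proof.
case/is_perm_mxP => s ->.
pose f (k : 'I_(n * r)) : 'I_(n * r) :=
  mxtens_index (s (@mxtens_unindex n r k).1, (@mxtens_unindex n r k).2).
have fI : injective f.
  move=> k l /(can_inj (@mxtens_indexK n r)) kl.
  apply: (can_inj (@mxtens_unindexK n r)); move: kl.
  by case: (@mxtens_unindex n r k) => a b; case: (@mxtens_unindex n r l) => c d
    /= [/perm_inj -> ->].
apply/is_perm_mxP; exists (perm fI); apply/matrixP => k l.
case: (mxtens_indexP k) => i j; case: (mxtens_indexP l) => i' j'.
rewrite tensmxE !mxE permE /f mxtens_indexK /=.
rewrite (can_eq (@mxtens_indexK n r)) xpair_eqE.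
by case: eqP; case: eqP; rewrite ?mulr0 ?mul0r ?mulr1.
Qed.

Lemma is_perm_mx_dsum n m (A : 'M[C]_n) (B : 'M[C]_m) :
  is_perm_mx A -> is_perm_mx B -> is_perm_mx (mxdsum A B).
Proof.
case/is_perm_mxP => s -> /is_perm_mxP [t ->].
pose g (u : 'I_n + 'I_m) : 'I_n + 'I_m :=
  match u with inl i => inl (s i) | inr j => inr (t j) end.
have gI : injective g by move=> [i|i] [j|j] //= [/perm_inj ->].
have fI : injective (fun k : 'I_(n + m) => fintype.unsplit (g (fintype.split k))).
  move=> k l /(can_inj (@unsplitK n m)) /gI.
  exact: (can_inj (@splitK n m)).
apply/is_perm_mxP; exists (perm fI); apply/matrixP => k l.
rewrite /mxdsum -[k]splitK -[l]splitK.
have -> M : perm_mx (perm fI) (fintype.unsplit (fintype.split k)) M =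
    (fintype.unsplit (g (fintype.split k)) == M)%:R :> C.
  by rewrite !mxE permE unsplitK.
rewrite (can_eq (@unsplitK n m)).
case: (fintype.split k) => a; case: (fintype.split l) => b;
  rewrite /= ?block_mxEul ?block_mxEur ?block_mxEdl ?block_mxEdr ?mxE //.
Qed.

End Matrices.

Record free_ultrafilter := FreeUltrafilter {
  uf : set_system nat;
  uf_ultra : UltraFilter uf;
  uf_free : forall k, ~ uf [set k]
}.
#[global] Existing Instance uf_ultra.

(* The complex numbers, typed so as to carry the library's norm topology. *)
Definition Cplx (R : realType) : numClosedFieldType := R[i]%C.
Arguments Cplx : simpl never.

Section Ultraproduct.
Variables (R : realType) (w : free_ultrafilter).
Notation C := (Cplx R).
Implicit Types n m r : nat -> nat.

Lemma cvg0_le (u v : nat -> C) : (forall k, 0 <= u k <= v k) ->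
  v k @[k --> uf w] --> (0 : C) -> u k @[k --> uf w] --> (0 : C).
Proof.
move=> uv /cvgr0Pnorm_lt v0; apply/cvgr0Pnorm_lt => e e0.
apply: filterS (v0 e e0) => k; have /andP[u0 uvk] := uv k.
by rewrite !ger0_norm ?(le_trans u0) //; exact: le_lt_trans.
Qed.

Lemma cvg0D (u v : nat -> C) : u k @[k --> uf w] --> (0 : C) ->
  v k @[k --> uf w] --> (0 : C) -> (u k + v k) @[k --> uf w] --> (0 : C).
Proof. by move=> u0 v0; rewrite -[0]addr0; exact: cvgD. Qed.

Lemma cvg0Z (c : C) (u : nat -> C) : u k @[k --> uf w] --> (0 : C) ->
  (c * u k) @[k --> uf w] --> (0 : C).
Proof. by move=> u0; rewrite -[0](mulr0 c); apply: cvgMr. Qed.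

(* Sequences bounded in operator norm; the ultraproduct [uprod n] of the
   M_(n k) is their quotient by 2-norm convergence of the difference to 0. *)
Record useq n := USeq {
  useq_val :> forall k, 'M[C]_(n k);
  useq_bounded : exists2 c : C, 0 <= c & forall k, opnorm_le (useq_val k) c
}.

HB.instance Definition _ n := gen_eqMixin (useq n).
HB.instance Definition _ n := gen_choiceMixin (useq n).

Definition ueq n (x y : useq n) : bool :=
  `[< norm2 (x k - y k) @[k --> uf w] --> (0 : C) >].

Lemma ueq_refl n : reflexive (@ueq n).
Proof.
move=> x; apply/asboolP; under eq_fun do rewrite subrr norm20.
exact: cvg_cst.
Qed.

Lemma ueq_sym n : symmetric (@ueq n).
Proof.
move=> x y; apply: asbool_equiv_eq.
by under eq_fun do rewrite -opprB norm2N.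
Qed.

Lemma ueq_trans n : transitive (@ueq n).
Proof.
move=> y x z /asboolP xy /asboolP yz; apply/asboolP.
apply: cvg0_le (cvg0D xy yz) => k; rewrite norm2_ge0 /=.
by apply: le_trans (norm2D _ _); rewrite addrA subrK.
Qed.

Canonical ueq_equiv n := EquivRel (@ueq n) (@ueq_refl n) (@ueq_sym n)
  (@ueq_trans n).

Definition uprod n := {eq_quot (@ueq n)}.
HB.instance Definition _ n := EqQuotient.on (uprod n).

Definition ucls n (x : useq n) : uprod n := \pi_(uprod n) x.

Lemma ucls_eq n (x y : useq n) :
  ucls x = ucls y <-> norm2 (x k - y k) @[k --> uf w] --> (0 : C).
Proof.
split=> [/eqmodP /asboolP //|xy].
by apply/eqmodP; exact/asboolP.
Qed.

Lemma ucls_ext n (x y : useq n) : (forall k, x k = y k) -> ucls x = ucls y.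
Proof.
move=> xy; apply/ucls_eq; have -> : (fun k => norm2 (x k - y k)) = cst 0.
  by apply/funext => k; rewrite xy subrr norm20.
exact: cvg_cst.
Qed.

Lemma ucls_repr n (x : useq n) :
  norm2 (repr (ucls x) k - x k) @[k --> uf w] --> (0 : C).
Proof. by apply/ucls_eq; exact: reprK. Qed.

Lemma uclsP n (X : uprod n) : exists x, X = ucls x.
Proof. by exists (repr X); rewrite [RHS]reprK. Qed.

(* Each operation on [uprod n] below is computed on canonical representatives;
   the lemma [...E] that follows it states independence of that choice. *)
Fact useq_mul_bounded n (x y : useq n) :
  exists2 c : C, 0 <= c & forall k, opnorm_le (x k *m y k) c.
Proof.
have [c c0 xc] := useq_bounded x; have [d d0 yd] := useq_bounded y.
exists (c * d); rewrite ?mulr_ge0 // => k v; rewrite -mulmxA.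
by apply: le_trans (xc k _) _; rewrite -mulrA ler_wpM2l //; exact: yd.
Qed.
Definition useq_mul n (x y : useq n) := USeq (useq_mul_bounded x y).
Definition umul n (X Y : uprod n) : uprod n := ucls (useq_mul (repr X) (repr Y)).

Lemma umulE n (x y : useq n) : umul (ucls x) (ucls y) = ucls (useq_mul x y).
Proof.
apply/ucls_eq; set x' := repr (ucls x); set y' := repr (ucls y).
have [c c0 xc] := useq_bounded x'; have [d d0 yd] := useq_bounded y.
apply: cvg0_le (cvg0D (cvg0Z c (ucls_repr y)) (cvg0Z d (ucls_repr x))) => k.
rewrite norm2_ge0 /= -/x' -/y'.
have -> : x' k *m y' k - x k *m y k =
    x' k *m (y' k - y k) + (x' k - x k) *m y k.
  by rewrite mulmxBr mulmxBl addrA subrK.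
by apply: le_trans (norm2D _ _) _; rewrite lerD // (norm2Ml, norm2Mr).
Qed.

Fact useq_adj_bounded n (x : useq n) :
  exists2 c : C, 0 <= c & forall k, opnorm_le ((x k)^t*) c.
Proof.
have [c c0 xc] := useq_bounded x.
by exists c => // k; exact: opnorm_le_adj.
Qed.
Definition useq_adj n (x : useq n) := USeq (useq_adj_bounded x).
Definition uadj n (X : uprod n) : uprod n := ucls (useq_adj (repr X)).

Lemma uadjE n (x : useq n) : uadj (ucls x) = ucls (useq_adj x).
Proof.
apply/ucls_eq; apply: cvg0_le (ucls_repr x) => k.
by rewrite norm2_ge0 /= -adjmxB norm2_adj.
Qed.

(* [lim] returns an arbitrary point on a divergent family; by [utr_cvg] below
   the limit always exists and depends on the class only. *)
Definition utr n (X : uprod n) : C := lim (ntr (repr X k) @[k --> uf w]).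

Fact useq_amp_bounded n r (x : useq n) :
  exists2 c : C, 0 <= c & forall k, opnorm_le (mxamp (r k) (x k)) c.
Proof.
have [c c0 xc] := useq_bounded x.
by exists c => // k; exact: opnorm_le_amp.
Qed.
Definition useq_amp n r (x : useq n) : useq (fun k => n k * r k)%N :=
  USeq (useq_amp_bounded r x).
Definition uamp n r (X : uprod n) : uprod (fun k => n k * r k)%N :=
  ucls (useq_amp r (repr X)).

Lemma uampE n r (x : useq n) : uamp r (ucls x) = ucls (useq_amp r x).
Proof.
apply/ucls_eq; apply: cvg0_le (ucls_repr x) => k.
by rewrite norm2_ge0 /= -mxampB norm2_amp.
Qed.

Fact useq_dsum_bounded n m (x : useq n) (y : useq m) :
  exists2 c : C, 0 <= c & forall k, opnorm_le (mxdsum (x k) (y k)) c.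
Proof.
have [c c0 xc] := useq_bounded x; have [d d0 yd] := useq_bounded y.
exists (c + d) => [|k]; first exact: addr_ge0.
apply: opnorm_le_dsum; first exact: addr_ge0.
  by move=> v; apply: le_trans (xc k v) _; rewrite ler_wpM2r ?fnorm_ge0 ?lerDl.
by move=> v; apply: le_trans (yd k v) _; rewrite ler_wpM2r ?fnorm_ge0 ?lerDr.
Qed.
Definition useq_dsum n m (x : useq n) (y : useq m) :
  useq (fun k => n k + m k)%N := USeq (useq_dsum_bounded x y).
Definition udsum n m (X : uprod n) (Y : uprod m) : uprod (fun k => n k + m k)%N :=
  ucls (useq_dsum (repr X) (repr Y)).

Lemma udsumE n m (x : useq n) (y : useq m) :
  udsum (ucls x) (ucls y) = ucls (useq_dsum x y).
Proof.
apply/ucls_eq; apply: cvg0_le (cvg0D (ucls_repr x) (ucls_repr y)) => k.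
by rewrite norm2_ge0 /= -mxdsumB norm2_dsum.
Qed.

(* Identification of the ultraproducts along two provably equal dimension
   sequences. *)
Fact useq_cast_bounded n m (e : forall k, n k = m k) (x : useq n) :
  exists2 c : C, 0 <= c & forall k, opnorm_le (mxcast (e k) (x k)) c.
Proof.
have [c c0 xc] := useq_bounded x.
by exists c => // k; exact: opnorm_le_cast.
Qed.
Definition useq_cast n m (e : forall k, n k = m k) (x : useq n) : useq m :=
  USeq (useq_cast_bounded e x).
Definition ucast n m (e : forall k, n k = m k) (X : uprod n) : uprod m :=
  ucls (useq_cast e (repr X)).

Lemma ucastE n m (e : forall k, n k = m k) (x : useq n) :
  ucast e (ucls x) = ucls (useq_cast e x).
Proof.
apply/ucls_eq; apply: cvg0_le (ucls_repr x) => k.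
by rewrite norm2_ge0 /= norm2_cast.
Qed.

(* Membership in the ultraproduct of the permutation groups P_(n k). *)
Definition uperm n (X : uprod n) : Prop :=
  exists x : useq n, (forall k, is_perm_mx (x k)) /\ X = ucls x.

Lemma uperm_amp n r (X : uprod n) : uperm X -> uperm (uamp r X).
Proof.
move=> [x [xP ->]]; exists (useq_amp r x); rewrite uampE; split=> // k.
exact: is_perm_mx_amp.
Qed.

Lemma uperm_dsum n m (X : uprod n) (Y : uprod m) :
  uperm X -> uperm Y -> uperm (udsum X Y).
Proof.
move=> [x [xP ->]] [y [yP ->]]; exists (useq_dsum x y); rewrite udsumE.
by split=> // k; exact: is_perm_mx_dsum.
Qed.

Lemma uampM n r (X Y : uprod n) :
  uamp r (umul X Y) = umul (uamp r X) (uamp r Y).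
Proof.
have [x ->] := uclsP X; have [y ->] := uclsP Y.
rewrite umulE !uampE umulE.
by apply: ucls_ext => k; exact: mxampM.
Qed.

Lemma udsumM n m (X X' : uprod n) (Y Y' : uprod m) :
  udsum (umul X X') (umul Y Y') = umul (udsum X Y) (udsum X' Y').
Proof.
have [x ->] := uclsP X; have [y ->] := uclsP Y.
have [x' ->] := uclsP X'; have [y' ->] := uclsP Y'.
rewrite (umulE x x') (umulE y y') !udsumE umulE.
by apply: ucls_ext => k; exact: mxdsumM.
Qed.

Lemma ultra_fmap T (u : nat -> T) : UltraFilter (u @ uf w).
Proof.
split=> [|G PG uG]; first exact: fmap_proper_filter.
apply/seteqP; split=> // A GA.
have [//|nA] := in_ultra_setVsetC (u @^-1` A) (uf_ultra w).
have /(filterI GA) : G (~` A) by apply: uG.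
by rewrite setICr => /filter_not_empty.
Qed.

Lemma ultra_cvg_real (u : nat -> R) (M : R) : (forall k, `|u k| <= M) ->
  exists l : R, u k @[k --> uf w] --> l.
Proof.
move=> uM; have := @segment_compact R (- M) M; rewrite compact_ultra.
case/(_ (u @ uf w) (ultra_fmap u)) => [|l [_ ul]]; last by exists l.
apply: (@filterE _ (uf w) _ (u @^-1` _)) => k.
by rewrite /= in_itv /= -ler_norml.
Qed.

Lemma cvg_complex (u : nat -> R) (l : R) : u k @[k --> uf w] --> l ->
  ((u k)%:C%C : C) @[k --> uf w] --> (l%:C%C : C).
Proof.
move=> /cvgrPdist_lt ul; apply/cvgrPdist_lt => e e0.
move: (e0); rewrite ltcE => /andP[/eqP ime re0].
apply: filterS (ul _ re0) => k /=; rewrite /= => h.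
have -> : e = (complex.Re e)%:C%C :> C by case: e ime {e0 re0 h} => a b /= ->.
by rewrite -rmorphB /= normc_def /= expr0n addr0 sqrtr_sqr ltcR.
Qed.

Lemma ultra_cvg_complex (u : nat -> C) (c : C) : (forall k, `|u k| <= c) ->
  cvg (u k @[k --> uf w]).
Proof.
move=> uc.
have [k|a ua] := @ultra_cvg_real (fun k => complex.Re (u k)) (complex.Re c).
  have := le_trans (normc_ge_Re (u k)) (uc k).
  by rewrite lecE /= => /andP[].
have [k|b ub] := @ultra_cvg_real (fun k => complex.Im (u k)) (complex.Re c).
  have := normc_ge_Re (u k * 'i%C); rewrite ReiNIm normrN normrM.
  rewrite [`|'i%C|]normc_def /= expr0n expr1n add0r sqrtr1 mulr1 => h.
  by have := le_trans h (uc k); rewrite lecE /= => /andP[].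
apply/cvg_ex; exists ((a%:C)%C + 'i%C * (b%:C)%C : C).
have -> : u = (fun k => ((complex.Re (u k))%:C)%C + 'i%C * ((complex.Im (u k))%:C)%C).
  by apply/funext => k; exact: complexE.
by apply: cvgD; [exact: cvg_complex | apply: cvgMr; exact: cvg_complex].
Qed.

Lemma utr_cvg n (x : useq n) : ntr (x k) @[k --> uf w] --> utr (ucls x).
Proof.
have [c c0 xc] := useq_bounded (repr (ucls x)).
have /(_ _) h := @ultra_cvg_complex (fun k => ntr (repr (ucls x) k)) c.
have {}h := h (fun k => ntr_le_opnorm c0 (xc k)).
have d0 : (ntr (repr (ucls x) k) - ntr (x k)) @[k --> uf w] --> (0 : C).
  apply/cvgr0Pnorm_lt => e e0.
  have /cvgr0Pnorm_lt/(_ e e0) := ucls_repr x.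
  apply: filterS => k; rewrite ger0_norm ?norm2_ge0 // => le.
  by rewrite -ntrB; apply: le_lt_trans (ntr_le _) le.
rewrite -[utr _]subr0.
have -> : (fun k => ntr (x k)) = (fun k => ntr (repr (ucls x) k) -
    (ntr (repr (ucls x) k) - ntr (x k))).
  by apply/funext => k; rewrite subKr.
exact: cvgB h d0.
Qed.

Lemma utrE n (x : useq n) (l : C) :
  ntr (x k) @[k --> uf w] --> l -> utr (ucls x) = l.
Proof.
by move=> xl; exact: (cvg_unique (@norm_hausdorff _ C) (@utr_cvg n x) xl).
Qed.

Lemma utr_amp n r (X : uprod n) : (forall k, 0 < r k)%N ->
  utr (uamp r X) = utr X.
Proof.
move=> r0; have [x ->] := uclsP X; rewrite uampE; apply: utrE => /=.
by under eq_fun do rewrite ntr_amp //; exact: (@utr_cvg _ x).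
Qed.

Lemma utr_dsum0 n m (X : uprod n) (Y : uprod m) :
  utr X = 0 -> utr Y = 0 -> utr (udsum X Y) = 0.
Proof.
have [x ->] := uclsP X; have [y ->] := uclsP Y => x0 y0.
rewrite udsumE; apply: utrE.
have := @utr_cvg _ x; have := @utr_cvg _ y.
rewrite x0 y0 => /cvg_norm + /cvg_norm; rewrite normr0 => {}y0 {}x0.
apply/cvgr0Pnorm_lt => e e0.
have /cvgr0Pnorm_lt /(_ e e0) := cvg0D x0 y0.
apply: filterS => k; rewrite ger0_norm ?addr_ge0 //.
exact: le_lt_trans (ntr_dsum _ _).
Qed.

End Ultraproduct.

Section SoficRepresentations.
Variables (R : realType) (w : free_ultrafilter) (G : groupType).

Record sofic_rep := SoficRep {
  sdim : nat -> nat;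
  sdim_gt0 : forall k, (0 < sdim k)%N;
  sdim_infty : sdim k @[k --> \oo] --> \oo;
  sfun :> G -> uprod R w sdim;
  sfun_perm : forall g, uperm (sfun g);
  sfunM : forall g h, sfun (g * h)%g = umul (sfun g) (sfun h);
  sfun_tr : forall g, g != 1%g -> utr (sfun g) = 0
}.

Section Amplification.
Variables (T : sofic_rep) (r : nat -> nat) (r_gt0 : forall k, (0 < r k)%N).

Fact amp_dim_gt0 k : (0 < sdim T k * r k)%N.
Proof. by rewrite muln_gt0 sdim_gt0 r_gt0. Qed.

Fact amp_dim_infty : (sdim T k * r k)%N @[k --> \oo] --> \oo.
Proof.
apply/cvgnyPge => A; have /cvgnyPge /(_ A) := @sdim_infty T.
by apply: filterS => k /leq_trans; apply; rewrite leq_pmulr.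
Qed.

Definition amp_fun g : uprod R w (fun k => sdim T k * r k)%N := uamp r (T g).

Fact amp_perm g : uperm (amp_fun g).
Proof. exact/uperm_amp/sfun_perm. Qed.

Fact ampM g h : amp_fun (g * h)%g = umul (amp_fun g) (amp_fun h).
Proof. by rewrite /amp_fun sfunM uampM. Qed.

Fact amp_tr g : g != 1%g -> utr (amp_fun g) = 0.
Proof. by move=> g1; rewrite utr_amp // sfun_tr. Qed.

Definition amplification : sofic_rep :=
  SoficRep amp_dim_gt0 amp_dim_infty amp_perm ampM amp_tr.
End Amplification.

Section DirectSum.
Variables T S : sofic_rep.

Fact dsum_dim_gt0 k : (0 < sdim T k + sdim S k)%N.
Proof. by rewrite addn_gt0 sdim_gt0. Qed.

Fact dsum_dim_infty : (sdim T k + sdim S k)%N @[k --> \oo] --> \oo.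
Proof.
apply/cvgnyPge => A; have /cvgnyPge /(_ A) := @sdim_infty T.
by apply: filterS => k /leq_trans; apply; rewrite leq_addr.
Qed.

Definition dsum_fun g : uprod R w (fun k => sdim T k + sdim S k)%N :=
  udsum (T g) (S g).

Fact dsum_perm g : uperm (dsum_fun g).
Proof. by apply: uperm_dsum; exact: sfun_perm. Qed.

Fact dsumM g h : dsum_fun (g * h)%g = umul (dsum_fun g) (dsum_fun h).
Proof. by rewrite /dsum_fun !sfunM udsumM. Qed.

Fact dsum_tr g : g != 1%g -> utr (dsum_fun g) = 0.
Proof. by move=> g1; rewrite utr_dsum0 // sfun_tr. Qed.

Definition direct_sum : sofic_rep :=
  SoficRep dsum_dim_gt0 dsum_dim_infty dsum_perm dsumM dsum_tr.
End DirectSum.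

Definition sofic_equiv (T S : sofic_rep) : Prop :=
  exists (r t : nat -> nat) (r_gt0 : forall k, (0 < r k)%N)
    (t_gt0 : forall k, (0 < t k)%N)
    (e : forall k, (sdim T k * r k = sdim S k * t k)%N)
    (u : uprod R w (fun k => sdim T k * r k)%N),
    uperm u /\
    forall g, ucast e (umul (umul u (amplification T r_gt0 g)) (uadj u)) =
              amplification S t_gt0 g.

Definition sofic_class (T : sofic_rep) : set sofic_rep :=
  [set S | sofic_equiv T S].

Definition Sof : set (set sofic_rep) := range sofic_class.

(* [conv_comb l X Y Z] reads Z = l X + (1 - l) Y. It is a relation, ranging over
   all representatives and all amplifications with the prescribed limit weight,
   so that it does not presuppose the independence of these choices. *)
Definition conv_comb (l : R) (X Y Z : set sofic_rep) : Prop :=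
  exists (T S : sofic_rep) (r t : nat -> nat) (r_gt0 : forall k, (0 < r k)%N)
    (t_gt0 : forall k, (0 < t k)%N),
    [/\ X = sofic_class T, Y = sofic_class S,
        (sdim T k * r k)%:R / (sdim T k * r k + sdim S k * t k)%:R
          @[k --> uf w] --> l
      & Z = sofic_class
              (direct_sum (amplification T r_gt0) (amplification S t_gt0))].

Definition sof_convex (F : set (set sofic_rep)) : Prop :=
  forall (l : R) X Y Z, 0 <= l <= 1 -> F X -> F Y -> conv_comb l X Y Z -> F Z.

Definition face (F : set (set sofic_rep)) : Prop :=
  [/\ F `<=` Sof, F !=set0, sof_convex F &
    forall (l : R) X Y Z, 0 < l < 1 -> Sof X -> Sof Y -> conv_comb l X Y Z ->
      F Z -> F X /\ F Y].

Definition minimal_face (F : set (set sofic_rep)) : Prop :=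
  face F /\ forall F', face F' -> ~ (F' `<` F).

Definition extreme_point (X : set sofic_rep) : Prop :=
  Sof X /\ forall (l : R) Y1 Y2, 0 < l < 1 -> Sof Y1 -> Sof Y2 ->
    conv_comb l Y1 Y2 X -> Y1 = X /\ Y2 = X.

End SoficRepresentations.

Arguments Sof R w G : clear implicits.

(* Main.v *)
(* Choosing permutations that represent a sofic representation turns it into a
   sequence of finite sets with an approximate action of G. Equivalence becomes
   existence, after amplification, of bijections commuting with the actions off
   a negligible set, and X = l Y + (1 - l) W becomes such a bijection from a
   multiple of X onto the disjoint union of multiples of Y and W.

   The set of all Y that occur with a weight in (0, 1) in a decomposition of X
   is a face. If F is a minimal face, this face is all of F for each X in F, so
   any two points X, Y of F occur in each other. Let s be the supremum of the
   weights of Y in X. A diagonal argument over the countable group G shows that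
   s is attained: X = s Y + (1 - s) W. If s < 1, then W lies in F, so Y occurs
   in W, and collecting both parts gives Y a weight larger than s in X. Hence
   s = 1, and then X = Y because a part of weight zero may be exchanged for any
   other. *)
Require Import Defs.
From mathcomp Require Import all_boot all_order all_algebra perm.
From mathcomp Require Import complex mxtens.
From mathcomp Require Import all_classical all_reals all_analysis.
From mathcomp Require Import zify ring lra.
From Corelib Require Setoid Morphisms.
Import Order.TTheory GRing.Theory Num.Theory.
Import numFieldNormedType.Exports.

Set Implicit Arguments.
Unset Strict Implicit.
Unset Printing Implicit Defensive.

Local Open Scope ring_scope.
Local Open Scope classical_set_scope.

(** * Negligible sequences and diagonal selection along the ultrafilter *)

Section Negligible.
Variable w : free_ultrafilter.

(* [e k / d k] tends to 0 along the ultrafilter. *)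
Definition negl (e d : nat -> nat) : Prop :=
  forall p, uf w [set k | (e k * p <= d k)%N].

Lemma uf_forall (P : set nat) : (forall k, P k) -> uf w P.
Proof. by move=> Pk; apply: filterS (filterT (F := uf w)) => k _; apply: Pk. Qed.

(** Freeness puts the complement of each singleton into the ultrafilter, so the indices below [N]
    can be removed one at a time. *)
Lemma uf_ge N : uf w [set k | (N <= k)%N].
Proof.
elim: N => [|N IH]; first exact: uf_forall.
have hN : uf w (~` [set N]).
  by have [/uf_free//|] := in_ultra_setVsetC [set N] (uf_ultra w).
apply: filterS (filterI IH hN) => k /= [Nk kN].
by rewrite ltn_neqAle Nk andbT; apply/eqP => Nk'; apply: kN.
Qed.

Lemma negl_le (e e' d : nat -> nat) : (forall k, e k <= e' k)%N ->
  negl e' d -> negl e d.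
Proof.
move=> ee' e'd p; apply: filterS (e'd p) => k /=; apply: leq_trans.
by rewrite leq_mul2r ee' orbT.
Qed.

Lemma neglD (e e' d : nat -> nat) :
  negl e d -> negl e' d -> negl (fun k => e k + e' k)%N d.
Proof.
(* Each summand is taken at [2 p], so that the two halves add up to the bound at [p]. *)
move=> ed e'd p; apply: filterS (filterI (ed (p * 2)%N) (e'd (p * 2)%N)) => k /=.
lia.
Qed.

Lemma neglMr (r e d : nat -> nat) :
  negl e d -> negl (fun k => e k * r k)%N (fun k => d k * r k)%N.
Proof.
move=> ed p; apply: filterS (ed p) => k /=; nia.
Qed.

Lemma negl_wid (e d d' : nat -> nat) : (forall k, d k <= d' k)%N ->
  negl e d -> negl e d'.
Proof.
by move=> dd' ed p; apply: filterS (ed p) => k /= /leq_trans; apply.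
Qed.

Lemma negl0 (d : nat -> nat) : negl (fun=> 0%N) d.
Proof. by move=> p; apply: uf_forall => k /=; rewrite mul0n. Qed.

(* The witness [nu k] is the largest [N <= k] for which [P N k] holds. *)
Lemma ultra_diagonal (P : nat -> nat -> Prop) : (forall k, P 0 k)%N ->
  (forall N, uf w (P N)) ->
  exists nu : nat -> nat, (forall k, P (nu k) k) /\
    forall N, uf w [set k | (N <= nu k)%N].
Proof.
move=> P0 PN.
pose nu k := (\max_(i < k.+1 | `[< P i k >]) i)%N.
exists nu; split=> [k|N].
  have h : `[< P (@ord0 k) k >] by apply/asboolP/P0.
  rewrite /nu; have [|i /asboolP Pi ->] := @eq_bigmax_cond _
    (fun i : 'I_k.+1 => `[< P i k >]) (@nat_of_ord k.+1).
    by apply/card_gt0P; exists ord0.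
  exact: Pi.
apply: filterS (filterI (PN N) (uf_ge N)) => k /= [Pk Nk].
have Nk' : (N < k.+1)%N by [].
apply: (@leq_bigmax_cond _ _ (@nat_of_ord k.+1) (Ordinal Nk')).
exact/asboolP.
Qed.

(** Injectivity leaves at most one [x] for each value of [f], hence each [N] involves only a finite
    intersection. It is applied to an injection of the countable group into [nat]. *)
Lemma uf_finite (T : Type) (f : T -> nat) (Q : T -> set nat) : injective f ->
  (forall x, uf w (Q x)) ->
  forall N, uf w [set k | forall x, (f x < N)%N -> Q x k].
Proof.
move=> fI Qx; elim=> [|N IH]; first by apply: uf_forall.
have [[x fx]|nx] := pselect (exists x, f x = N).
  apply: filterS (filterI IH (Qx x)) => k /= [hN hx] y.
  by rewrite ltnS leq_eqVlt => /predU1P [|/hN//]; rewrite -fx => /fI ->.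
apply: filterS IH => k /= hN y; rewrite ltnS leq_eqVlt => /predU1P [fy|/hN//].
by case: nx; exists y.
Qed.

End Negligible.

(** * Finite sets with maps indexed by the group, and failure of equivariance *)

Section FiniteActions.
Local Open Scope set_scope.
Variable G : Type.

(* The group law plays no role in approximate isomorphisms, so that the maps
   [gact g] are arbitrary. *)
Record gset := GSet { gcar :> finType; gact : G -> gcar -> gcar }.

Definition gamp (r : nat) (A : gset) : gset :=
  @GSet (A * 'I_r)%type (fun g x => (gact g x.1, x.2)).

Definition gsum (A B : gset) : gset :=
  @GSet (A + B)%type (fun g x => match x with
    | inl a => inl (gact g a) | inr b => inr (gact g b) end).

Definition defect (A B : gset) (phi : A -> B) (g : G) : nat :=
  #|[set x | phi (gact g x) != gact g (phi x)]|.

Lemma card_gamp r A : #|gamp r A| = (#|A| * r)%N.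
Proof. by rewrite card_prod card_ord. Qed.

Lemma card_gsum A B : #|gsum A B| = (#|A| + #|B|)%N.
Proof. by rewrite card_sum. Qed.

Lemma defect0 (A B : gset) (phi : A -> B) g :
  (forall x, phi (gact g x) = gact g (phi x)) -> defect phi g = 0%N.
Proof. by move=> h; apply: eq_card0 => x; rewrite !inE h eqxx. Qed.

(** If [x] is bad for the composite, then [x] is bad for [phi] or [phi x] is bad for [psi].
    Injectivity of [phi] allows all bad points to be counted by their images in [B]. *)
Lemma defect_comp (A B C : gset) (phi : A -> B) (psi : B -> C) g :
  injective phi -> (defect (psi \o phi) g <= defect phi g + defect psi g)%N.
Proof.
move=> phiI; rewrite /defect -(card_imset _ phiI).
rewrite -(card_imset [set x | phi (gact g x) != _] phiI).
set P := imset _ _; set Q := imset _ _; set S := finset _.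
apply: leq_trans (leq_card_setU Q S).
apply/subset_leq_card/fintype.subsetP => y /imsetP [x]; rewrite !inE /= => h ->.
have [e|ne] := eqVneq (phi (gact g x)) (gact g (phi x)).
  by rewrite -e h orbT.
by apply/orP; left; rewrite imset_f // inE ne.
Qed.

(** [phi] carries its own bad points onto those of [psi]. *)
Lemma defect_inv (A B : gset) (phi : A -> B) (psi : B -> A) g :
  cancel phi psi -> cancel psi phi -> defect psi g = defect phi g.
Proof.
move=> phiK psiK; rewrite /defect -(card_imset _ (can_inj phiK)).
apply: eq_card => y.
rewrite -{2}[y]psiK (mem_imset _ _ (can_inj phiK)) !inE psiK.
by rewrite -{1}[gact g y]psiK -(inj_eq (can_inj phiK)) !psiK eq_sym.
Qed.

Lemma defect_amp (A B : gset) r (phi : A -> B) g :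
  defect (A := gamp r A) (B := gamp r B) (fun x => (phi x.1, x.2)) g =
  (defect phi g * r)%N.
Proof.
rewrite -[X in (_ * X)%N](card_ord r) -[in X in (_ * X)%N]cardsT -cardsX /defect.
apply: eq_card => /= [[x i]].
by rewrite !inE /= andbT -pair_eqE /pair_eq /= eqxx andbT.
Qed.

Definition sum_map (A B A' B' : Type) (phi : A -> B) (psi : A' -> B')
  (x : A + A') : B + B' :=
  match x with inl a => inl (phi a) | inr b => inr (psi b) end.

Lemma sum_map_bij (A B A' B' : Type) (phi : A -> B) (psi : A' -> B') :
  bijective phi -> bijective psi -> bijective (sum_map phi psi).
Proof.
move=> [f fK Kf] [h hK Kh]; exists (sum_map f h) => -[x|x] /=;
  by rewrite ?fK ?hK ?Kf ?Kh.
Qed.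

Lemma card_sum_pred (A B : finType) (P : pred (A + B)) :
  #|P| = (#|[pred a | P (inl a)]| + #|[pred b | P (inr b)]|)%N.
Proof. by rewrite -!sum1_card big_sumType. Qed.

Lemma defect_sum (A B A' B' : gset) (phi : A -> B) (psi : A' -> B') g :
  defect (A := gsum A A') (B := gsum B B') (sum_map phi psi) g =
  (defect phi g + defect psi g)%N.
Proof.
rewrite /defect cardsE card_sum_pred !cardsE.
by congr addn; apply: eq_card => x; rewrite !inE.
Qed.

End FiniteActions.

(** * Asymptotic isomorphism, compatible with multiples and disjoint unions *)

Section AsymptoticIsomorphism.
Variables (w : free_ultrafilter) (G : Type).
Implicit Types M N P : nat -> gset G.

Definition mamp (r : nat -> nat) M : nat -> gset G := fun k => gamp (r k) (M k).
Definition mplus M N : nat -> gset G := fun k => gsum (M k) (N k).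
Definition mcard M (k : nat) : nat := #|M k|.

(** Only equivariance is approximate. The maps are bijective at every index, so cardinalities agree
    exactly and weights can be computed without error terms. *)
Definition miso M N : Prop :=
  exists2 phi : forall k, M k -> N k, forall k, bijective (phi k) &
    forall g, negl w (fun k => defect (phi k) g) (mcard M).

Lemma miso_card M N : miso M N -> forall k, mcard M k = mcard N k.
Proof. by move=> [phi phiB _] k; exact: bij_eq_card (phiB k). Qed.

Lemma miso_exact M N (phi : forall k, M k -> N k) :
  (forall k, bijective (phi k)) ->
  (forall k g x, phi k (gact g x) = gact g (phi k x)) -> miso M N.
Proof.
move=> phiB phiG; exists phi => // g.
have -> : (fun k => defect (phi k) g) = fun=> 0%N.
  by apply/funext => k; apply: defect0.
exact: negl0.
Qed.

Lemma miso_refl M : miso M M.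
Proof. by apply: (@miso_exact _ _ (fun k => id)) => // k; exists id. Qed.

Lemma miso_sym M N : miso M N -> miso N M.
Proof.
move=> MN; have cMN := miso_card MN; move: MN => [phi phiB phiG].
have /all_sig2 [psi phiK psiK] k :
    {psi | cancel (phi k) psi & cancel psi (phi k)}.
  by apply: cid2; case: (phiB k) => psi; exists psi.
exists psi => [k|g]; first by exists (phi k).
have -> : (fun k => defect (psi k) g) = (fun k => defect (phi k) g).
  by apply/funext => k; exact: defect_inv.
by have -> : mcard N = mcard M by apply/funext => k; rewrite cMN.
Qed.

Lemma miso_trans M N P : miso M N -> miso N P -> miso M P.
Proof.
move=> MN; have cMN := miso_card MN; move: MN => [phi phiB phiG].
move=> [psi psiB psiG]; exists (fun k => psi k \o phi k) => [k|g].
  exact: bij_comp.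
have cE : mcard M = mcard N by apply/funext => k; rewrite cMN.
apply: negl_le (neglD (phiG g) _) => [k|]; last by rewrite cE; exact: psiG.
exact/defect_comp/bij_inj.
Qed.

Lemma miso_amp r M N : miso M N -> miso (mamp r M) (mamp r N).
Proof.
move=> [phi phiB phiG]; exists (fun k x => (phi k x.1, x.2)) => [k|g].
  by case: (phiB k) => f fK Kf; exists (fun x => (f x.1, x.2)) => -[x i] /=;
    rewrite ?fK ?Kf.
have -> : mcard (mamp r M) = fun k => (mcard M k * r k)%N.
  by apply/funext => k; exact: card_gamp.
apply: negl_le (neglMr r (phiG g)) => k; by rewrite -defect_amp.
Qed.

Lemma miso_sum M N M' N' :
  miso M N -> miso M' N' -> miso (mplus M M') (mplus N N').
Proof.
move=> [phi phiB phiG] [psi psiB psiG].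
exists (fun k => sum_map (phi k) (psi k)) => [k|g]; first exact: sum_map_bij.
apply: (@negl_le _ _ (fun k => defect (phi k) g + defect (psi k) g)%N).
  by move=> k; rewrite -defect_sum.
by apply: neglD; [move: (phiG g)|move: (psiG g)]; apply: negl_wid => k;
  rewrite /mcard card_gsum ?leq_addr ?leq_addl.
Qed.

Lemma mampA r s M : miso (mamp s (mamp r M)) (mamp (fun k => r k * s k)%N M).
Proof.
apply: (@miso_exact (mamp s (mamp r M)) (mamp (fun k => r k * s k)%N M)
  (fun k x => (x.1.1, mxtens_index (x.1.2, x.2)))) => // k.
exists (fun y => (y.1, (mxtens_unindex y.2).1, (mxtens_unindex y.2).2)).
  by case=> [[x i] j]; rewrite mxtens_indexK.
case=> [x i]; rewrite -[RHS]/(x, i) -[in RHS](mxtens_unindexK i).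
by rewrite -surjective_pairing.
Qed.

Lemma mampD r s M :
  miso (mamp (fun k => r k + s k)%N M) (mplus (mamp r M) (mamp s M)).
Proof.
apply: miso_sym.
apply: (@miso_exact (mplus (mamp r M) (mamp s M))
  (mamp (fun k => r k + s k)%N M) (fun k x => match x with
  | inl y => (y.1, lshift (s k) y.2) | inr y => (y.1, rshift (r k) y.2) end)).
- move=> k; exists (fun y => match fintype.split y.2 with
    | inl i => inl (y.1, i) | inr i => inr (y.1, i) end).
    by case=> [[x i]|[x i]] /=; rewrite ?(unsplitK (inl i)) ?(unsplitK (inr i)).
  by case=> [x i] /=; case: splitP => j ij; congr pair; apply: val_inj.
- by move=> k g [x|x].
Qed.

Lemma mamp_sum r M N : miso (mamp r (mplus M N)) (mplus (mamp r M) (mamp r N)).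
Proof.
apply: (@miso_exact (mamp r (mplus M N)) (mplus (mamp r M) (mamp r N))
  (fun k x => match x.1 with
   | inl a => inl (a, x.2) | inr b => inr (b, x.2) end)).
- move=> k; exists (fun y => match y with
    | inl z => (inl z.1, z.2) | inr z => (inr z.1, z.2) end).
    by case=> [[x|x] i].
  by case=> [[x i]|[x i]].
- by move=> k g [[x|x] i].
Qed.

Lemma mplusC M N : miso (mplus M N) (mplus N M).
Proof.
apply: (@miso_exact (mplus M N) (mplus N M)
  (fun k x => match x with inl a => inr a | inr b => inl b end)).
  move=> k; exists (fun x => match x with inl a => inr a | inr b => inl b end);
    by case.
by move=> k g [x|x].
Qed.

Lemma mplusA M N P : miso (mplus (mplus M N) P) (mplus M (mplus N P)).
Proof.
apply: (@miso_exact (mplus (mplus M N) P) (mplus M (mplus N P))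
  (fun k x => match x with
   | inl (inl a) => inl a | inl (inr b) => inr (inl b)
   | inr c => inr (inr c) end)).
  move=> k; exists (fun x => match x with
   | inl a => inl (inl a) | inr (inl b) => inl (inr b)
   | inr (inr c) => inr c end).
    by case=> [[x|x]|x].
  by case=> [x|[x|x]].
by move=> k g [[x|x]|x].
Qed.

(** Any bijection from [N] to [N'] serves: its defect is at most the cardinality of [N], which is
    negligible. This is how a part of weight zero is exchanged for another. *)
Lemma miso_small M N N' : (forall k, mcard N k = mcard N' k) ->
  negl w (mcard N) (mcard (mplus M N)) -> miso (mplus M N) (mplus M N').
Proof.
move=> NN' Nsmall.
have /all_sig [phi phiB] k : {phi : N k -> N' k | bijective phi}.
  apply: cid; exists (fun x => enum_val (cast_ord (NN' k) (enum_rank x))).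
  exists (fun x => enum_val (cast_ord (esym (NN' k)) (enum_rank x))) => x;
    by rewrite enum_valK ?cast_ordK ?cast_ordKV enum_rankK.
exists (fun k => sum_map id (phi k)) => [k|g].
  by apply: sum_map_bij => //; exists id.
apply: negl_le Nsmall => k; rewrite defect_sum defect0 // add0n.
exact: max_card.
Qed.

#[global] Instance miso_equivalence : RelationClasses.Equivalence miso.
Proof.
split=> [M|M N|M N P]; first exact: miso_refl.
  exact: miso_sym.
exact: miso_trans.
Qed.

#[global] Instance mamp_proper r : Morphisms.Proper
  (Morphisms.respectful miso miso) (mamp r).
Proof. by move=> M N; exact: miso_amp. Qed.

#[global] Instance mplus_proper : Morphisms.Proper
  (Morphisms.respectful miso (Morphisms.respectful miso miso)) mplus.
Proof. by move=> M N MN M' N'; exact: miso_sum. Qed.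

End AsymptoticIsomorphism.
#[global] Hint Resolve miso_refl : core.

Local Open Scope sesquilinear_scope.

(** * Norm, trace, multiples and sums of permutation matrices in terms of permutations *)

Section PermutationMatrices.
Variable C : numClosedFieldType.

Lemma perm_mx_adj n (s : 'S_n) : (perm_mx s : 'M[C]_n)^t* = perm_mx s^-1%g.
Proof.
rewrite tr_perm_mx; apply/matrixP => i j; rewrite !mxE.
by case: eqP => _; rewrite ?conjC1 ?conjC0.
Qed.

Lemma opnorm_le_perm n (s : 'S_n) : opnorm_le (perm_mx s : 'M[C]_n) 1.
Proof.
move=> v; rewrite mul1r /fnorm adjmxM mulmxA -[_ *m _ *m perm_mx s]mulmxA.
by rewrite perm_mx_adj -perm_mxM mulVg perm_mx1 mulmx1.
Qed.

(** The Hamming distance before normalisation. *)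
Definition disagree (T T' : finType) (f g : T -> T') : nat :=
  #|[set x | f x != g x]%SET|.

(** A row [i] with [s i != t i] has exactly two nonzero entries in the difference, [1] and [-1]; the
    other rows vanish. Hence the factor 2. *)
Lemma norm2_perm_sqr n (s t : 'S_n) :
  norm2 (perm_mx s - perm_mx t : 'M[C]_n) ^+ 2 = (disagree s t * 2)%:R / n%:R.
Proof.
rewrite norm2E exprMn fnorm_sqr exprVn sqrtCK; congr (_ / _).
rewrite natrM /disagree -sum1_card natr_sum mulr_suml.
rewrite [RHS]big_mkcond; apply: eq_bigr => i _ /=; rewrite inE.
have [st|st] /= := eqVneq (s i) (t i).
  by rewrite big1 // => j _; rewrite !mxE st subrr normr0 expr0n.
rewrite (bigD1 (s i)) //= (bigD1 (t i)) 1?eq_sym //= big1 => [|j /andP[js jt]].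
  rewrite !mxE !eqxx (negPf st) eq_sym (negPf st).
  by rewrite subr0 sub0r normrN !normr1 expr1n addr0 mul1r.
by rewrite !mxE eq_sym (negPf js) eq_sym (negPf jt) subr0 normr0 expr0n.
Qed.

Lemma ntr_perm n (s : 'S_n) :
  ntr (perm_mx s : 'M[C]_n) = (#|[set x | s x == x]%SET|)%:R / n%:R.
Proof.
rewrite /ntr /mxtrace -sum1_card natr_sum [in RHS]big_mkcond; congr (_ / _).
by apply: eq_bigr => i _; rewrite !mxE inE; case: eqP.
Qed.

Lemma amp_perm_subproof r n (s : 'S_n) : injective (fun x : 'I_(n * r) =>
  mxtens_index (s (mxtens_unindex x).1, (mxtens_unindex x).2)).
Proof.
move=> x y; case: (mxtens_indexP x) => i j; case: (mxtens_indexP y) => i' j'.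
move=> /(can_inj (@mxtens_indexK n r)); rewrite !mxtens_indexK.
by case=> /perm_inj -> ->.
Qed.

Definition amp_perm r n (s : 'S_n) : 'S_(n * r) :=
  perm (@amp_perm_subproof r n s).

Lemma mxamp_perm r n (s : 'S_n) :
  mxamp r (perm_mx s : 'M[C]_n) = perm_mx (amp_perm r s).
Proof.
apply/matrixP => x y; case: (mxtens_indexP x) => i j.
case: (mxtens_indexP y) => i' j'; rewrite tensmxE !mxE permE mxtens_indexK /=.
by rewrite (can_eq (@mxtens_indexK n r)) xpair_eqE -natrM mulnb.
Qed.

Lemma sum_perm_subproof n m (s : 'S_n) (t : 'S_m) : injective
  (fun x : 'I_(n + m) => fintype.unsplit (sum_map s t (fintype.split x))).
Proof.
move=> x y /(can_inj (@unsplitK n m)) xy; apply: (can_inj (@splitK n m)).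
by move: xy; case: fintype.split => a; case: fintype.split => b //=;
  case=> /perm_inj ->.
Qed.

Definition sum_perm n m (s : 'S_n) (t : 'S_m) : 'S_(n + m) :=
  perm (@sum_perm_subproof n m s t).

Lemma mxdsum_perm n m (s : 'S_n) (t : 'S_m) :
  mxdsum (perm_mx s : 'M[C]_n) (perm_mx t) = perm_mx (sum_perm s t).
Proof.
apply/matrixP => x y; rewrite -[x]splitK -[y]splitK /mxdsum.
have -> z : (perm_mx (sum_perm s t) : 'M[C]_(n + m))
      (fintype.unsplit (fintype.split x)) z =
    (fintype.unsplit (sum_map s t (fintype.split x)) == z)%:R.
  by rewrite !mxE permE unsplitK.
rewrite (can_eq (@unsplitK n m)).
case: (fintype.split x) => a; case: (fintype.split y) => b;
  by rewrite /= ?block_mxEul ?block_mxEur ?block_mxEdl ?block_mxEdr ?mxE.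
Qed.

Lemma mxcast_perm n m (e : n = m) (s : 'S_n) :
  mxcast e (perm_mx s : 'M[C]_n) = perm_mx (cast_perm e s).
Proof. by case: _ / e; rewrite /mxcast castmx_id. Qed.

End PermutationMatrices.

(** Products of permutations act from left to right, so the conjugate sends [v^-1 x] to
    [v^-1 (a x)]. After this substitution the right side is the defect of the bijection
    [x |-> cast_ord e (v^-1 x)] from [a] to [b]. *)
Lemma disagree_conj n m (e : n = m) (v a : 'S_n) (b : 'S_m) :
  disagree (cast_perm e (v * a * v^-1)%g) b =
  disagree (fun x => cast_ord e (v^-1%g (a x)))
    (fun x => b (cast_ord e (v^-1%g x))).
Proof.
case: _ / e b => b; rewrite /disagree /= -(card_imset _ (@perm_inj _ v)).
apply: eq_card => x.
rewrite -[x](permKV v) (mem_imset _ _ (@perm_inj _ v)) !inE.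
by rewrite !cast_ord_id !permM !permKV.
Qed.

(** * Elements of the ultraproduct of permutation groups, described by negligible counts *)

Section Ultraproduct.
Variables (R : realType) (w : free_ultrafilter).
Notation C := (Cplx R).
Implicit Types n m r : nat -> nat.

(** In the partial order of the complex numbers [0 < x] forces [x] to be real, which reduces the
    claim to the real case. *)
Lemma arch_Cplx (x : C) : 0 < x -> exists p : nat, x < p%:R.
Proof.
move=> x0; have xE : x = ((complex.Re x)%:C)%C :> C.
  by move: x0; case: x => a b; rewrite ltcE /= => /andP[/eqP-> _].
exists (Num.bound (complex.Re x)); rewrite {1}xE.
have -> : (Num.bound (complex.Re x))%:R =
    ((Num.bound (complex.Re x))%:R%:C)%C :> C.
  by rewrite rmorph_nat.
rewrite ltcR; apply: archi_boundP.
by move: x0; rewrite {1}xE (ltcR 0) => /ltW.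
Qed.

(** The parameters let one argument serve twice: [c = i = 2] for the 2-norm of a difference of
    permutation matrices, [c = i = 1] for the trace of one. *)
Lemma cvg0_negl (u : nat -> C) (c i : nat) (e d : nat -> nat) :
  (forall k, 0 <= u k) -> (0 < c)%N -> (0 < i)%N -> (forall k, 0 < d k)%N ->
  (forall k, u k ^+ i = (e k * c)%:R / (d k)%:R) ->
  (u k @[k --> uf w] --> (0 : C)) <-> negl w e d.
Proof.
move=> u0 c0 i0 d0 uE.
have key k (t : C) : 0 <= t -> (u k < t) = ((e k * c)%:R < t ^+ i * (d k)%:R).
  by move=> t0; rewrite -ltr_pdivrMr ?ltr0n // -uE ltr_pXn2r ?nnegrE.
split=> [u0'|ed].
  (* At this threshold [u k < t] says [e k * c * p.+1 < d k], which is stronger than the bound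
     required for [p]. *)
  move=> p; have t0 : 0 < (i.-root (p.+1%:R^-1) : C).
    by rewrite rootC_gt0 // invr_gt0 ltr0n.
  move/cvgr0Pnorm_lt: u0' => /(_ _ t0); apply: filterS => k /=.
  rewrite ger0_norm // key ?ltW // rootCK // mulrC ltr_pdivlMr ?ltr0n //.
  rewrite -natrM ltr_nat; nia.
apply/cvgr0Pnorm_lt => eps eps0.
(* With this [p], [e k * p <= d k] gives [e k * c < eps ^+ i * d k] as soon as [e k] is positive. *)
have [|p pe] := @arch_Cplx (c%:R / eps ^+ i).
  by rewrite divr_gt0 ?ltr0n ?exprn_gt0.
apply: filterS (ed p) => k /= h.
rewrite ger0_norm // key ?ltW //.
move: pe; rewrite ltr_pdivrMr ?exprn_gt0 // => pe.
have [->|e0] := posnP (e k); first by rewrite mul0n mulr_gt0 ?exprn_gt0 ?ltr0n.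
apply: (@lt_le_trans _ _ ((e k)%:R * (p%:R * eps ^+ i))).
  by rewrite natrM ltr_pM2l ?ltr0n.
by rewrite mulrA mulrC -natrM ler_pM2l ?exprn_gt0 // ler_nat.
Qed.

Fact perm_useq_bounded n (s : forall k, 'S_(n k)) :
  exists2 c : C, 0 <= c & forall k, opnorm_le (perm_mx (s k) : 'M[C]_(n k)) c.
Proof. by exists 1 => // k; exact: opnorm_le_perm. Qed.
Definition perm_useq n (s : forall k, 'S_(n k)) : useq R n :=
  USeq (perm_useq_bounded s).
Definition ucls_perm n (s : forall k, 'S_(n k)) : uprod R w n :=
  ucls w (perm_useq s).

Lemma ucls_perm_eq n (s t : forall k, 'S_(n k)) : (forall k, 0 < n k)%N ->
  ucls_perm s = ucls_perm t <-> negl w (fun k => disagree (s k) (t k)) n.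
Proof.
move=> n0; apply: iff_trans (ucls_eq _ _ _) _.
apply: (@cvg0_negl _ 2 2) => // k; first exact: norm2_ge0.
exact: norm2_perm_sqr.
Qed.

Lemma utr_perm n (s : forall k, 'S_(n k)) : (forall k, 0 < n k)%N ->
  utr (ucls_perm s) = 0 <->
  negl w (fun k => #|[set x | s k x == x]%SET|) n.
Proof.
move=> n0.
apply: (@iff_trans _ (ntr (perm_useq s k) @[k --> uf w] --> (0 : C))).
  split=> [<-|]; [exact: utr_cvg|exact: utrE].
apply: (@cvg0_negl _ 1 1) => // k.
  by rewrite ntr_perm divr_ge0.
by rewrite expr1 muln1 ntr_perm.
Qed.

Lemma uperm_ucls n (X : uprod R w n) :
  uperm X <-> exists s : forall k, 'S_(n k), X = ucls_perm s.
Proof.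
split=> [[x [xP ->]]|[s ->]]; last first.
  by exists (perm_useq s); split=> // k; exact: perm_mx_is_perm.
have /all_sig [s sE] k : {s | x k = perm_mx s}.
  by apply: cid; case/is_perm_mxP: (xP k) => s; exists s.
by exists s; exact: ucls_ext.
Qed.

Lemma umul_perm n (s t : forall k, 'S_(n k)) :
  umul (ucls_perm s) (ucls_perm t) = ucls_perm (fun k => s k * t k)%g.
Proof. by rewrite umulE; apply: ucls_ext => k /=; rewrite perm_mxM. Qed.

Lemma uadj_perm n (s : forall k, 'S_(n k)) :
  uadj (ucls_perm s) = ucls_perm (fun k => (s k)^-1)%g.
Proof. by rewrite uadjE; apply: ucls_ext => k /=; exact: perm_mx_adj. Qed.

Lemma uamp_perm n r (s : forall k, 'S_(n k)) :
  uamp r (ucls_perm s) = ucls_perm (fun k => amp_perm (r k) (s k)).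
Proof. by rewrite uampE; apply: ucls_ext => k /=; exact: mxamp_perm. Qed.

Lemma udsum_perm n m (s : forall k, 'S_(n k)) (t : forall k, 'S_(m k)) :
  udsum (ucls_perm s) (ucls_perm t) = ucls_perm (fun k => sum_perm (s k) (t k)).
Proof. by rewrite udsumE; apply: ucls_ext => k /=; exact: mxdsum_perm. Qed.

Lemma ucast_perm n m (e : forall k, n k = m k) (s : forall k, 'S_(n k)) :
  ucast e (ucls_perm s) = ucls_perm (fun k => cast_perm (e k) (s k)).
Proof. by rewrite ucastE; apply: ucls_ext => k /=; exact: mxcast_perm. Qed.

End Ultraproduct.

(** * Sofic representations as sequences of permutations with negligible errors *)

Section Models.
Variables (R : realType) (w : free_ultrafilter) (G : groupType).
Notation sofic := (sofic_rep R w G).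
Notation ucls_perm := (@ucls_perm R w _).

Lemma sofic_permsP (T : sofic) :
  exists p : forall g k, 'S_(sdim T k), forall g, T g = ucls_perm (p g).
Proof.
have /all_sig [p pT] g : {s : forall k, 'S_(sdim T k) | T g = ucls_perm s}.
  by apply/cid/uperm_ucls/sfun_perm.
by exists p.
Qed.

(** A fixed choice of representing permutations. At a given index they need not form an action of
    [G]; multiplicativity holds off negligible sets only. *)
Definition sofic_perms (T : sofic) : forall g k, 'S_(sdim T k) :=
  sval (cid (sofic_permsP T)).

Lemma sofic_permsE (T : sofic) g : T g = ucls_perm (sofic_perms T g).
Proof. exact: svalP (cid (sofic_permsP T)) g. Qed.

Definition perm_model n (p : forall (g : G) (k : nat), 'S_(n k)) : nat -> gset G :=
  fun k => @GSet G 'I_(n k) (fun g => p g k).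

Definition model (T : sofic) : nat -> gset G := perm_model (sofic_perms T).

Lemma mcard_model (T : sofic) : mcard (model T) = sdim T.
Proof. by apply/funext => k; exact: card_ord. Qed.

(** Two representatives of one element differ on a negligible set, so the identity map is an
    asymptotic isomorphism. Thus the choice made in [sofic_perms] is immaterial. *)
Lemma model_perms (T : sofic) (p : forall g k, 'S_(sdim T k)) :
  (forall g, T g = ucls_perm (p g)) -> miso w (model T) (perm_model p).
Proof.
move=> pT; exists (fun k => id) => [k|g]; first by exists id.
rewrite mcard_model; apply/(ucls_perm_eq R); first exact: sdim_gt0.
by rewrite -pT -sofic_permsE.
Qed.

(** The amplification carries permutations chosen afresh; [model_perms] trades them for the
    amplified ones, for which the indexing bijection is exactly equivariant. [model_sum] follows the
    same pattern. *)
Lemma model_amp (T : sofic) r (r_gt0 : forall k, (0 < r k)%N) :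
  miso w (model (amplification T r_gt0)) (mamp r (model T)).
Proof.
apply: miso_trans (@model_perms (amplification T r_gt0)
  (fun g k => amp_perm (r k) (sofic_perms T g k)) _) _.
  by move=> g; rewrite -uamp_perm -sofic_permsE.
apply: (@miso_exact _ _ (perm_model _) (mamp r (model T))
  (fun k => @mxtens_unindex (sdim T k) (r k))) => [k|k g x].
  exists (@mxtens_index _ _); [exact: mxtens_unindexK|exact: mxtens_indexK].
by rewrite /= permE mxtens_indexK.
Qed.

Lemma model_sum (T S : sofic) :
  miso w (model (direct_sum T S)) (mplus (model T) (model S)).
Proof.
apply: miso_trans (@model_perms (direct_sum T S)
  (fun g k => sum_perm (sofic_perms T g k) (sofic_perms S g k)) _) _.
  by move=> g; rewrite -udsum_perm -!sofic_permsE.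
apply: (@miso_exact _ _ (perm_model _) (mplus (model T) (model S))
  (fun k => @fintype.split (sdim T k) (sdim S k))) => [k|k g x].
  exists (@fintype.unsplit _ _); [exact: splitK|exact: unsplitK].
by rewrite /= permE unsplitK; case: fintype.split.
Qed.

(** A conjugating element represented by [v] corresponds to the bijection [v^-1] between the models;
    by [disagree_conj] the error of the conjugation is the defect of this bijection. *)
Lemma conjugate_model (T S : sofic) :
  (exists (e : forall k, sdim T k = sdim S k) (u : uprod R w (sdim T)),
     uperm u /\ forall g, ucast e (umul (umul u (T g)) (uadj u)) = S g) <->
  miso w (model T) (model S).
Proof.
have conjE e v g :
    ucast e (umul (umul (ucls_perm v) (T g)) (uadj (ucls_perm v))) = S g <->
    negl w (fun k => disagree
      (fun x => cast_ord (e k) ((v k)^-1%g (sofic_perms T g k x)))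
      (fun x => sofic_perms S g k (cast_ord (e k) ((v k)^-1%g x)))) (sdim T).
  rewrite (sofic_permsE T) (sofic_permsE S) uadj_perm !umul_perm ucast_perm.
  apply: iff_trans (@ucls_perm_eq R w _ _ _ (@sdim_gt0 _ _ _ S)) _.
  under [X in negl w X _ <-> _]eq_fun do rewrite disagree_conj.
  have eTS : sdim T = sdim S by apply/funext.
  by rewrite [X in _ <-> negl w _ X]eTS.
split=> [[e [u [/uperm_ucls [v ->] uT]]]|TS].
  exists (fun k x => cast_ord (e k) ((v k)^-1%g x)) => [k|g].
    exists (fun y => v k (cast_ord (esym (e k)) y)) => x.
      by rewrite cast_ordK permKV.
    by rewrite permK cast_ordKV.
  by rewrite mcard_model; apply/conjE.
have e k : sdim T k = sdim S k by have := miso_card TS k; rewrite !mcard_model.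
case: TS => phi phiB phiG; exists e.
have fI k : injective (fun x => cast_ord (esym (e k)) (phi k x)).
  by move=> x y /cast_ord_inj /(bij_inj (phiB k)).
(* The inverse is taken because conjugation by [v] corresponds to the bijection [v^-1], which has to
   be [phi]. *)
pose v k := (perm (fI k))^-1%g.
exists (ucls_perm v); split; first by apply/uperm_ucls; exists v.
move=> g; apply/conjE; move: (phiG g); rewrite mcard_model; apply: negl_le => k.
apply: eq_leq; apply: eq_card => x; rewrite !inE /v invgK !permE.
by rewrite !cast_ordKV.
Qed.

Lemma sofic_equivP (T S : sofic) : sofic_equiv T S <->
  exists r t : nat -> nat, [/\ forall k, (0 < r k)%N, forall k, (0 < t k)%N &
    miso w (mamp r (model T)) (mamp t (model S))].
Proof.
split=> [[r [t [r0 [t0 [e [u uP]]]]]]|[r [t [r0 t0 h]]]].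
  exists r, t; split=> //.
  have /conjugate_model h : exists (e : forall k, sdim (amplification T r0) k =
      sdim (amplification S t0) k) (u : uprod R w (sdim (amplification T r0))),
      uperm u /\ forall g, ucast e (umul (umul u (amplification T r0 g))
        (uadj u)) = amplification S t0 g by exists e, u.
  by rewrite -(model_amp T r0) h model_amp.
have /conjugate_model [e [u uP]] :
  miso w (model (amplification T r0)) (model (amplification S t0)).
  by rewrite !model_amp.
by exists r, t, r0, t0, e, u.
Qed.

(** * Building a sofic representation from permutations that are multiplicative and free up to
    negligible sets *)

Section PermSofic.
Variables (n : nat -> nat) (p : forall (g : G) (k : nat), 'S_(n k)).
Hypothesis n_gt0 : forall k, (0 < n k)%N.
Hypothesis n_infty : n k @[k --> \oo] --> \oo.
Hypothesis p_mul : forall g h,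
  negl w (fun k => disagree (p (g * h)%g k) (p g k * p h k)%g) n.
Hypothesis p_free : forall g, g != 1%g ->
  negl w (fun k => #|[set x | p g k x == x]%SET|) n.

Definition perm_fun g : uprod R w n := ucls_perm (p g).

Fact perm_fun_perm g : uperm (perm_fun g).
Proof. by apply/uperm_ucls; exists (p g). Qed.

Fact perm_funM g h : perm_fun (g * h)%g = umul (perm_fun g) (perm_fun h).
Proof. by rewrite umul_perm; apply/ucls_perm_eq. Qed.

Fact perm_fun_tr g : g != 1%g -> utr (perm_fun g) = 0.
Proof. by move=> g1; apply/utr_perm => //; exact: p_free. Qed.

Definition perm_sofic : sofic :=
  SoficRep n_gt0 n_infty perm_fun_perm perm_funM perm_fun_tr.

Lemma model_perm_sofic : miso w (model perm_sofic) (perm_model p).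
Proof. exact: (@model_perms perm_sofic). Qed.
End PermSofic.

Lemma sofic_perms_mul (T : sofic) g h :
  negl w (fun k => disagree (sofic_perms T (g * h)%g k)
    (sofic_perms T g k * sofic_perms T h k)%g) (sdim T).
Proof.
apply/(ucls_perm_eq R); first exact: sdim_gt0.
by rewrite -umul_perm -!sofic_permsE Defs.sfunM.
Qed.

Lemma sofic_perms_free (T : sofic) g : g != 1%g ->
  negl w (fun k => #|[set x | sofic_perms T g k x == x]%SET|) (sdim T).
Proof.
move=> g1; apply/(utr_perm R); first exact: sdim_gt0.
by rewrite -sofic_permsE sfun_tr.
Qed.

End Models.

(** * Splittings of a sequence of finite sets into two parts, with a limit weight *)

Section Splittings.
Variables (R : realType) (w : free_ultrafilter) (G : Type).
Implicit Types (M N P : nat -> gset G) (l : R).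

Definition weight N M (k : nat) : R := (mcard N k)%:R / (mcard M k)%:R.

(** The finite form of [M = l N + (1 - l) P], without multiplicities; [l] is the limiting proportion
    of [N] in [M]. *)
Definition msplit l M N P : Prop :=
  miso w M (mplus N P) /\ weight N M k @[k --> uf w] --> l.

Lemma mcard_amp r M k : mcard (mamp r M) k = (mcard M k * r k)%N.
Proof. exact: card_gamp. Qed.

Lemma mcard_plus M N k : mcard (mplus M N) k = (mcard M k + mcard N k)%N.
Proof. exact: card_gsum. Qed.

Lemma mamp_eq r s M : (forall k, r k = s k) -> miso w (mamp r M) (mamp s M).
Proof. by move=> /funext ->. Qed.

Lemma mamp1 M : miso w (mamp (fun=> 1%N) M) M.
Proof.
apply: (@miso_exact _ _ (mamp (fun=> 1%N) M) M (fun k x => x.1)) => // k.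
by exists (fun x => (x, ord0)) => // -[x i] /=; rewrite (ord1 i).
Qed.

Lemma weight_miso M M' N N' : miso w M M' -> miso w N N' ->
  weight N M = weight N' M'.
Proof.
by move=> /miso_card cM /miso_card cN; apply/funext => k; rewrite /weight cM cN.
Qed.

Lemma weight_amp r M N : (forall k, 0 < r k)%N ->
  weight (mamp r N) (mamp r M) = weight N M.
Proof.
move=> r0; apply/funext => k; rewrite /weight !mcard_amp !natrM.
by rewrite invfM mulrACA divff ?mulr1 // pnatr_eq0 -lt0n.
Qed.

Lemma msplit_amp l r M N P : (forall k, 0 < r k)%N -> msplit l M N P ->
  msplit l (mamp r M) (mamp r N) (mamp r P).
Proof.
move=> r0 [iMNP lMN]; split; last by rewrite weight_amp.
by rewrite iMNP mamp_sum.
Qed.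

Lemma msplit_miso l M N P M' N' P' : miso w M M' -> miso w N N' ->
  miso w P P' -> msplit l M N P -> msplit l M' N' P'.
Proof.
move=> MM' NN' PP' [iMNP lMN]; split; last by rewrite -(weight_miso MM' NN').
by rewrite -MM' -NN' -PP'.
Qed.

Lemma msplit_card l M N P k : msplit l M N P ->
  mcard M k = (mcard N k + mcard P k)%N.
Proof. by case=> /miso_card -> _; exact: mcard_plus. Qed.

Lemma msplit_ge0_le1 l M N P : msplit l M N P -> 0 <= l <= 1.
Proof.
move=> MNP; have [_ lMN] := MNP; have wM k : 0 <= weight N M k <= 1.
  rewrite divr_ge0 //= /weight (msplit_card _ MNP).
  (* On an empty set the weight is 0, by the convention that the inverse of 0 is 0. *)
  have [->|h] := posnP (mcard N k + mcard P k)%N; first by rewrite invr0 mulr0.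
  by rewrite ler_pdivrMr ?ltr0n // mul1r ler_nat leq_addr.
apply/andP; split.
  by apply: (cvgr_to_ge lMN); apply: nearW => k; case/andP: (wM k).
by apply: (cvgr_to_le lMN); apply: nearW => k; case/andP: (wM k).
Qed.

Lemma msplitC l M N P : (forall k, 0 < mcard M k)%N ->
  msplit l M N P -> msplit (1 - l) M P N.
Proof.
move=> M0 MNP; have [iMNP lMN] := MNP; split; first by rewrite iMNP mplusC.
have -> : weight P M = fun k => 1 - weight N M k.
  apply/funext => k; have := M0 k.
  rewrite /weight (msplit_card k MNP) -(ltr0n R) natrD => h.
  by field; rewrite gt_eqF.
exact: cvgB (cvg_cst _) lMN.
Qed.

(** Proportions multiply at each index: [N1] in [M] is [N1] in [N] times [N] in [M], where a
    nonempty [N] cancels. *)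
Lemma msplitA l m M N P N1 N2 : (forall k, 0 < mcard N k)%N ->
  msplit l M N P -> msplit m N N1 N2 -> msplit (l * m) M N1 (mplus N2 P).
Proof.
move=> N0 [iM lM] [iN lN]; split; first by rewrite iM iN mplusA.
have -> : weight N1 M = fun k => weight N M k * weight N1 N k.
  apply/funext => k.
  by rewrite /weight [RHS]mulrC mulrA divfK // pnatr_eq0 -lt0n.
exact: cvgM.
Qed.

End Splittings.

(** * Calculus of convex combinations of sofic representations *)

Section Combinations.
Variables (R : realType) (w : free_ultrafilter) (G : groupType).
Notation sofic := (sofic_rep R w G).
Implicit Types (X Y Z W T S V : sofic) (l s : R).

Lemma model_gt0 X k : (0 < mcard (model X) k)%N.
Proof. by rewrite mcard_model sdim_gt0. Qed.

Lemma amp_model_gt0 r X k : (0 < r k)%N -> (0 < mcard (mamp r (model X)) k)%N.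
Proof. by move=> r0; rewrite mcard_amp muln_gt0 model_gt0. Qed.

Lemma sofic_equiv_refl X : sofic_equiv X X.
Proof. by apply/sofic_equivP; exists (fun=> 1%N), (fun=> 1%N); split=> //. Qed.

Lemma sofic_equiv_sym X Y : sofic_equiv X Y -> sofic_equiv Y X.
Proof.
case/sofic_equivP => r [t [r0 t0 XY]]; apply/sofic_equivP; exists t, r.
by split=> //; exact: miso_sym.
Qed.

Lemma sofic_equiv_trans X Y Z :
  sofic_equiv X Y -> sofic_equiv Y Z -> sofic_equiv X Z.
Proof.
case/sofic_equivP => r [t [r0 t0 XY]] /sofic_equivP [r' [t' [r'0 t'0 YZ]]].
(* Both multiples become [Y] amplified by [t k * r' k]. *)
apply/sofic_equivP; exists (fun k => r k * r' k)%N, (fun k => t' k * t k)%N.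
split=> [k|k|]; rewrite ?muln_gt0 ?r0 ?r'0 ?t0 ?t'0 //.
rewrite -(mampA w r r') XY mampA -(mampA w t' t) -YZ mampA.
by apply: mamp_eq => k; rewrite mulnC.
Qed.

Lemma sofic_classP X Y : sofic_class X = sofic_class Y <-> sofic_equiv X Y.
Proof.
split=> [XY|XY].
  have : sofic_class Y Y by exact: sofic_equiv_refl.
  by rewrite -XY.
apply/seteqP; split=> Z /=; apply: sofic_equiv_trans => //.
exact: sofic_equiv_sym.
Qed.

(** Reads [X = l Y + (1 - l) W] on representatives rather than classes. The combination comes first
    here, whereas [conv_comb] has it last. *)
Definition comb l X Y W : Prop :=
  exists a b c : nat -> nat, [/\ forall k, (0 < a k)%N, forall k, (0 < b k)%N,
    forall k, (0 < c k)%N &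
    msplit w l (mamp a (model X)) (mamp b (model Y)) (mamp c (model W))].

Lemma comb_equiv l X Y W X' Y' W' : sofic_equiv X X' -> sofic_equiv Y Y' ->
  sofic_equiv W W' -> comb l X Y W -> comb l X' Y' W'.
Proof.
case/sofic_equivP => x [x' [x0 x'0 XX']] /sofic_equivP [y [y' [y0 y'0 YY']]].
case/sofic_equivP => z [z' [z0 z'0 WW']] [a [b [c [a0 b0 c0 XYW]]]].
(* The splitting is amplified by [x * y * z], so that each of the three terms contains the factor
   needed to pass to its equivalent; a common amplification keeps the weight. *)
exists (fun k => x' k * (a k * (y k * z k)))%N,
  (fun k => y' k * (b k * (x k * z k)))%N,
  (fun k => z' k * (c k * (x k * y k)))%N.
split=> [k|k|k|]; rewrite ?muln_gt0 ?x'0 ?y'0 ?z'0 ?a0 ?b0 ?c0 ?x0 ?y0 ?z0 //.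
have r0 k : (0 < x k * (y k * z k))%N by rewrite !muln_gt0 x0 y0 z0.
apply: msplit_miso (msplit_amp r0 XYW).
- rewrite -(mampA w x') -XX' !mampA; apply: mamp_eq => k; ring.
- rewrite -(mampA w y') -YY' !mampA; apply: mamp_eq => k; ring.
- rewrite -(mampA w z') -WW' !mampA; apply: mamp_eq => k; ring.
Qed.

(** [conv_comb] allows any representatives of the three classes; [comb_equiv] moves the splitting
    from them to the given [X], [Y] and [W]. *)
Lemma conv_combP l X Y W :
  conv_comb l (sofic_class Y) (sofic_class W) (sofic_class X) <-> comb l X Y W.
Proof.
split=> [[T [S [r [t [r0 [t0 [YT WS lTS XTS]]]]]]]|].
  move/sofic_classP/sofic_equiv_sym: YT; move/sofic_classP/sofic_equiv_sym: WS.
  move/sofic_classP/sofic_equiv_sym: XTS => XTS WS YT.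
  apply: comb_equiv XTS YT WS _.
  exists (fun=> 1%N), r, t; split=> //; split.
    by rewrite mamp1 model_sum !model_amp.
  suff -> : weight R (mamp r (model T)) (mamp (fun=> 1%N) (model
    (direct_sum (amplification T r0) (amplification S t0)))) = fun k =>
    (sdim T k * r k)%:R / (sdim T k * r k + sdim S k * t k)%:R by [].
  by apply/funext => k; rewrite /weight !mcard_amp !mcard_model muln1.
case=> a [b [c [a0 b0 c0 XYW]]]; exists Y, W, b, c, b0, c0; split=> //.
  case: (XYW) => _; set f := weight R _ _; suff -> : f = fun k =>
    (sdim Y k * b k)%:R / (sdim Y k * b k + sdim W k * c k)%:R by [].
  apply/funext => k; rewrite /f /weight (msplit_card k XYW) !mcard_amp.
  by rewrite !mcard_model.
apply/sofic_classP/sofic_equivP; exists a, (fun=> 1%N); split=> //.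
by rewrite mamp1 model_sum !model_amp; case: XYW.
Qed.

Lemma comb_ge0_le1 l X Y W : comb l X Y W -> 0 <= l <= 1.
Proof. by case=> a [b [c [_ _ _]]]; exact: msplit_ge0_le1. Qed.

Lemma combC l X Y W : comb l X Y W -> comb (1 - l) X W Y.
Proof.
case=> a [b [c [a0 b0 c0 XYW]]]; exists a, c, b; split=> //.
by apply: msplitC => // k; exact: amp_model_gt0.
Qed.

(** The parts [b Y] and [c Y] together form [(b + c) Y]. This makes a single class convex. *)
Lemma comb_self l X Y : comb l X Y Y -> sofic_equiv X Y.
Proof.
case=> a [b [c [a0 b0 c0 [iXY _]]]]; apply/sofic_equivP.
exists a, (fun k => b k + c k)%N; split=> //; last by rewrite mampD.
by move=> k; rewrite addn_gt0 b0.
Qed.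

(** Serves to place each point in the face that it generates. *)
Lemma comb_half X : comb (1 / 2) X X X.
Proof.
exists (fun k => 1 + 1)%N, (fun=> 1%N), (fun=> 1%N); split=> //.
split; first by rewrite mampD.
suff -> : weight R (mamp (fun=> 1%N) (model X))
  (mamp (fun=> 1 + 1)%N (model X)) = fun=> 1 / 2 by exact: cvg_cst.
apply/funext => k; rewrite /weight !mcard_amp muln1 natrM.
by rewrite invfM mulrA divff // pnatr_eq0 -lt0n model_gt0.
Qed.

(** A part of a part is a part: the remainder collects [V2] and [W]. *)
Lemma combA s l X Y W V1 V2 : comb s X Y W -> comb l Y V1 V2 ->
  exists W', comb (s * l) X V1 W'.
Proof.
case=> a [b [c [a0 b0 c0 XYW]]] [b' [p [q [b'0 p0 q0 YV]]]].
have qb0 k : (0 < q k * b k)%N by rewrite muln_gt0 q0 b0.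
have cb0 k : (0 < c k * b' k)%N by rewrite muln_gt0 c0 b'0.
(* Amplifying the first splitting by [b'] and the second by [b] gives both of them [b * b'] copies
   of [Y], so the second can be substituted into the first. *)
exists (direct_sum (amplification V2 qb0) (amplification W cb0)).
exists (fun k => a k * b' k)%N, (fun k => p k * b k)%N, (fun=> 1%N).
split=> [k|k||] //; rewrite ?muln_gt0 ?a0 ?p0 ?b0 ?b'0 //.
have XYW' := msplit_amp b'0 XYW; have YV' := msplit_amp b0 YV.
have YE : miso w (mamp b (mamp b' (model Y))) (mamp b' (mamp b (model Y))).
  by rewrite !mampA; apply: mamp_eq => k; rewrite mulnC.
have {}YV' := msplit_miso YE (miso_refl _ _) (miso_refl _ _) YV'.
apply: msplit_miso (msplitA _ XYW' YV') => [||| k].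
- exact: mampA.
- exact: mampA.
- by rewrite mamp1 model_sum !model_amp !mampA.
- by rewrite mcard_amp muln_gt0 b'0 amp_model_gt0.
Qed.

(** The copies of [Y] inside [W] join those already split off from [X]. For [s < 1] and [0 < m] the
    new weight exceeds [s]. *)
Lemma comb_line s m X Y W V : comb s X Y W -> comb m W Y V ->
  comb (s + (1 - s) * m) X Y V.
Proof.
case=> a [b [c [a0 b0 c0 XYW]]] [a' [b' [c' [a'0 b'0 c'0 WYV]]]].
(* Amplifying the first splitting by [a'] and the second by [c] matches the multiplicity [a' * c] of
   [W]. *)
exists (fun k => a k * a' k)%N, (fun k => b k * a' k + b' k * c k)%N,
  (fun k => c' k * c k)%N.
split=> [k|k|k|]; rewrite ?addn_gt0 ?muln_gt0 ?a0 ?a'0 ?b0 ?c0 ?c'0 //.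
have [iX lX] := XYW; have [iW lW] := WYV; split.
  rewrite mampD -!(mampA w) iX mamp_sum mplusA; apply: miso_sum; first by [].
  rewrite mampA (mamp_eq w _ (fun k => mulnC (c k) (a' k))) -mampA iW mamp_sum.
  by rewrite !mampA.
have nz Z k : (mcard (model Z) k)%:R != 0 :> R.
  by rewrite pnatr_eq0 -lt0n model_gt0.
set f := weight R _ _.
have -> : f = fun k => weight R (mamp b (model Y)) (mamp a (model X)) k +
   weight R (mamp c (model W)) (mamp a (model X)) k *
   weight R (mamp b' (model Y)) (mamp a' (model W)) k.
  apply/funext => k; rewrite /f /weight !mcard_amp !natrM natrD !natrM.
  field; rewrite !nz !pnatr_eq0 -!lt0n a0 a'0 //.
apply: cvgD lX _; apply: cvgM lW.
by have [] := msplitC (fun k => amp_model_gt0 X (a0 k)) XYW.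
Qed.

(** An amount [l / s] of [X] contains an amount [l] of [Y], and [(1 - l) / s'] of [X] contains
    [1 - l] of [Y']. Together they contain one unit of [V], whose weight is therefore the inverse of
    the total amount of [X]. *)
Lemma comb_convex s s' l X Y Y' W W' V : 0 < s < 1 -> 0 < s' < 1 ->
  comb s X Y W -> comb s' X Y' W' -> comb l V Y Y' ->
  exists u U, 0 < u < 1 /\ comb u X V U.
Proof.
move=> s01 s'01 [a [b [c [a0 b0 c0 XYW]]]] [a' [b' [c' [a'0 b'0 c'0 XYW']]]].
move=> [d [p [q [d0 p0 q0 VYY]]]].
have l01 := msplit_ge0_le1 VYY.
have cp0 k : (0 < c k * (p k * b' k))%N by rewrite !muln_gt0 c0 p0 b'0.
have cq0 k : (0 < c' k * (q k * b k))%N by rewrite !muln_gt0 c'0 q0 b0.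
exists (l / s + (1 - l) / s')^-1.
exists (direct_sum (amplification W cp0) (amplification W' cq0)).
have [s0 s1] := andP s01; have [s'0 s'1] := andP s'01; have [l0 l1] := andP l01.
have D1 : 1 < l / s + (1 - l) / s'.
  have i1 : 1 < s^-1 by rewrite invf_gt1.
  have i1' : 1 < s'^-1 by rewrite invf_gt1.
  (* The total minus 1 is [l (1/s - 1) + (1 - l) (1/s' - 1)]. Its first term is strictly positive
     only for [l != 0], so [l = 0] is treated apart. *)
  have [->|ln0] := eqVneq l 0; first by rewrite mul0r add0r subr0 mul1r.
  have lp : 0 < l by rewrite lt_neqAle eq_sym ln0.
  have h1 : 0 < l * (s^-1 - 1) by rewrite mulr_gt0 ?subr_gt0.
  have h2 : 0 <= (1 - l) * (s'^-1 - 1) by rewrite mulr_ge0 ?subr_ge0 // ltW.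
  lra.
have D0 : 0 < l / s + (1 - l) / s' by apply: lt_trans D1.
split; first by rewrite invr_gt0 D0 invf_lt1.
(* These multiples of [X] contain [p * (b * b')] copies of [Y] and [q * (b * b')] of [Y'], which
   make up [d * (b * b')] copies of [V]. *)
exists (fun k => a k * (p k * b' k) + a' k * (q k * b k))%N,
  (fun k => d k * (b k * b' k))%N, (fun=> 1%N); split=> [k|k||] //.
- by rewrite addn_gt0 !muln_gt0 a0 p0 b'0.
- by rewrite !muln_gt0 d0 b0 b'0.
have [iX lX] := XYW; have [iX' lX'] := XYW'; have [iV lV] := VYY; split.
  rewrite mamp1 mampD -!(mampA w a) -!(mampA w a') iX iX' -(mampA w d) iV.
  rewrite model_sum !model_amp !mamp_sum !mampA.
  rewrite (@mamp_eq w G (fun k => b k * (p k * b' k))%N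
    (fun k => p k * (b k * b' k))%N); last by move=> k; ring.
  rewrite (@mamp_eq w G (fun k => b' k * (q k * b k))%N
    (fun k => q k * (b k * b' k))%N); last by move=> k; ring.
  rewrite !mplusA; apply: miso_sum => //.
  by rewrite -!mplusA; apply: miso_sum => //; rewrite mplusC.
set f := weight R _ _.
have nz Z k : (mcard (model Z) k)%:R != 0 :> R.
  by rewrite pnatr_eq0 -lt0n model_gt0.
have nz' (e : nat -> nat) k : (0 < e k)%N -> (e k)%:R != 0 :> R.
  by rewrite pnatr_eq0 -lt0n.
have -> : f = fun k => (weight R (mamp p (model Y)) (mamp d (model V)) k /
      weight R (mamp b (model Y)) (mamp a (model X)) k +
   weight R (mamp q (model Y')) (mamp d (model V)) k /
      weight R (mamp b' (model Y')) (mamp a' (model X)) k)^-1.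
  apply/funext => k; rewrite /f /weight !mcard_amp !natrM natrD !natrM.
  field; rewrite !nz !nz' // -!natrM -!natrD !pnatr_eq0 -!lt0n.
  by rewrite !addn_gt0 !muln_gt0 model_gt0 a0 p0 b'0.
apply: cvgV; first by rewrite gt_eqF.
apply: cvgD.
  by apply: cvgM lV _; apply: cvgV lX; rewrite gt_eqF.
apply: cvgM; last by apply: cvgV lX'; rewrite gt_eqF.
by have [] := msplitC (fun k => amp_model_gt0 V (d0 k)) VYY.
Qed.

Lemma weight0_negl (M N : nat -> gset G) : (forall k, 0 < mcard M k)%N ->
  weight R N M k @[k --> uf w] --> (0 : R) -> negl w (mcard N) (mcard M).
Proof.
move=> M0 NM0 p; have p0 : 0 < p.+1%:R^-1 :> R by rewrite invr_gt0 ltr0n.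
apply: filterS (cvgr_lt _ NM0 _ p0) => k /=.
rewrite ltr_pdivrMr ?ltr0n // mulrC ltr_pdivlMr ?ltr0n // -natrM ltr_nat; nia.
Qed.

(** The part [W] has weight zero, so [miso_small] exchanges it for copies of [Y] of the same total
    size. *)
Lemma comb1 X Y W : comb 1 X Y W -> sofic_equiv X Y.
Proof.
case=> a [b [c [a0 b0 c0 XYW]]]; apply/sofic_equivP.
(* Amplified by [sdim Y k], the part [W] has [c k * sdim W k * sdim Y k] points, exactly the size of
   [c k * sdim W k] copies of [Y]. *)
exists (fun k => a k * sdim Y k)%N, (fun k => b k * sdim Y k + c k * sdim W k)%N.
split=> [k|k|]; rewrite ?addn_gt0 ?muln_gt0 ?a0 ?b0 ?sdim_gt0 //.
have [iX _] := msplit_amp (@sdim_gt0 _ _ _ Y) XYW.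
have X0 k : (0 < mcard (mamp (sdim Y) (mamp a (model X))) k)%N.
  by rewrite !mcard_amp !muln_gt0 sdim_gt0 model_gt0 a0.
have /(weight0_negl X0) small : weight R (mamp (sdim Y) (mamp c (model W)))
    (mamp (sdim Y) (mamp a (model X))) k @[k --> uf w] --> (0 : R).
  rewrite weight_amp; last exact: sdim_gt0.
  by have [_] := msplitC (fun k => amp_model_gt0 X (a0 k)) XYW; rewrite subrr.
rewrite -(mampA w a) iX mampD -(mampA w b); apply: miso_small => [k|].
  by rewrite !mcard_amp !mcard_model; ring.
have -> : mcard (mplus (mamp (sdim Y) (mamp b (model Y)))
    (mamp (sdim Y) (mamp c (model W)))) = mcard (mamp (sdim Y) (mamp a (model X))).
  by apply/funext => k; rewrite (miso_card iX).
exact: small.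
Qed.

(** Prepares the diagonal argument: the second part has multiplicity one, and its dimension has a
    lower bound that depends on the index alone. *)
Lemma comb_normal l X Y W : comb l X Y W ->
  exists (V : sofic) (a b : nat -> nat),
  [/\ forall k, (0 < a k)%N, forall k, (0 < b k)%N,
    forall k, (k <= sdim V k)%N &
    msplit w l (mamp a (model X)) (mamp b (model Y)) (model V)].
Proof.
case=> a [b [c [a0 b0 c0 XYW]]].
(* The extra factor [k.+1] forces the dimension of the second part to be at least [k]. *)
have ck0 k : (0 < c k * k.+1)%N by rewrite muln_gt0 c0.
exists (amplification W ck0), (fun k => a k * k.+1)%N, (fun k => b k * k.+1)%N.
split=> [k|k|k|]; rewrite ?muln_gt0 ?a0 ?b0 //=.
  by have := sdim_gt0 W k; have := c0 k; nia.
apply: msplit_miso (mampA w a succn _) (mampA w b succn _) _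
  (msplit_amp (fun=> ltn0Sn _) XYW).
by rewrite model_amp mampA.
Qed.

(** Diagonal argument: at index [k] the part [W] is taken from decomposition number [nu k], with
    [nu] from [ultra_diagonal]. Countability of [G] lets stage [N] control only the finitely many
    elements with [f g < N]. *)
Lemma comb_closed s X Y : countable [set: G] ->
  (forall N : nat, exists l W, N%:R * `|l - s| < 1 /\ comb l X Y W) ->
  exists W, comb s X Y W.
Proof.
move=> /countable_injP [f fI] close.
have {}fI : injective f by move=> g h; apply: fI; rewrite inE.
have H N : exists u : R * sofic * (nat -> nat) * (nat -> nat),
    let: (l, V, a, b) := u in N%:R * `|l - s| < 1 /\
    [/\ forall k, (0 < a k)%N, forall k, (0 < b k)%N,
      forall k, (k <= sdim V k)%N &
    msplit w l (mamp a (model X)) (mamp b (model Y)) (model V)].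
  have [l [W [ls /comb_normal [V [a [b h]]]]]] := close N.
  by exists (l, V, a, b).
have {H close} [u uP] := choice H.
pose l N := (u N).1.1.1; pose V N := (u N).1.1.2; pose a N := (u N).1.2.
pose b N := (u N).2.
have {uP} uP N : N%:R * `|l N - s| < 1 /\
    [/\ forall k, (0 < a N k)%N, forall k, (0 < b N k)%N,
     forall k, (k <= sdim (V N) k)%N &
     msplit w (l N) (mamp (a N) (model X)) (mamp (b N) (model Y))
       (model (V N))].
  by rewrite /l /V /a /b; move: (uP N); case: (u N) => [[[? ?] ?] ?].
have ls N : N%:R * `|l N - s| < 1 by case: (uP N).
have a0 N k : (0 < a N k)%N by case: (uP N) => _ [].
have b0 N k : (0 < b N k)%N by case: (uP N) => _ [].
have Vk N k : (k <= sdim (V N) k)%N by case: (uP N) => _ [].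
have /all_sig2 [phi phiB phiG] N : {phi : forall k,
    mamp (a N) (model X) k -> mplus (mamp (b N) (model Y)) (model (V N)) k |
    forall k, bijective (phi k) &
    forall g, negl w (fun k => defect (phi k) g) (mcard (mamp (a N) (model X)))}.
  by apply: cid2; case: (uP N) => _ [_ _ _ [[phi]]]; exists phi.
pose wt N k := weight R (mamp (b N) (model Y)) (mamp (a N) (model X)) k.
(* Stage [N] is good at [k] when, on these elements, equivariance, multiplicativity and freeness
   fail on a proportion of at most [1/N], and the weight is within [1/N] of [s]. *)
pose P N k :=
  [/\ forall g, (f g < N)%N -> (defect (phi N k) g * N <= sdim X k * a N k)%N,
   forall g, (f g < N)%N -> forall h, (f h < N)%N ->
     (disagree (sofic_perms (V N) (g * h)%g k)
       (sofic_perms (V N) g k * sofic_perms (V N) h k)%g * N <= sdim (V N) k)%N,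
   forall g, (f g < N)%N -> g != 1%g ->
     (#|[set x | sofic_perms (V N) g k x == x]%SET| * N <= sdim (V N) k)%N &
   N%:R * `|wt N k - s| < 1].
have [k|N|nu [Pnu nu_infty]] := @ultra_diagonal w P.
(* At [N = 0] no group element is constrained and the last condition reads [0 < 1]. *)
- by split=> //; rewrite mul0r.
- have h1 : uf w [set k | forall g, (f g < N)%N ->
      (defect (phi N k) g * N <= sdim X k * a N k)%N].
    apply: (uf_finite fI) => g; have := phiG N g N.
    by apply: filterS => k /=; rewrite mcard_amp mcard_model.
  have h2 : uf w [set k | forall g, (f g < N)%N -> forall h, (f h < N)%N ->
     (disagree (sofic_perms (V N) (g * h)%g k)
       (sofic_perms (V N) g k * sofic_perms (V N) h k)%g * N
       <= sdim (V N) k)%N].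
    apply: (uf_finite fI) => g.
    exact: (uf_finite fI (fun h => sofic_perms_mul (V N) g h N)).
  have h3 : uf w [set k | forall g, (f g < N)%N -> g != 1%g ->
     (#|[set x | sofic_perms (V N) g k x == x]%SET| * N <= sdim (V N) k)%N].
    apply: (uf_finite fI) => g.
    have [->|g1] := eqVneq g 1%g; first by apply: uf_forall => k /eqP.
    by apply: filterS (sofic_perms_free (V N) g1 N) => k.
  have h4 : uf w [set k | N%:R * `|wt N k - s| < 1].
    have wl : (N%:R * `|wt N k - s|) @[k --> uf w] --> N%:R * `|l N - s|.
      apply: cvgM; first exact: cvg_cst.
      apply: cvg_norm; apply: cvgB; last exact: cvg_cst.
      by case: (uP N) => _ [_ _ _ []].
    exact: cvgr_lt wl _ (ls N).
  by apply: filterS (filterI (filterI h1 h2) (filterI h3 h4)) => k;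
    case=> -[? ?] [? ?].
have uf_nu N (Q : nat -> Prop) : (forall k, (N <= nu k)%N -> Q k) -> uf w Q.
  by move=> NQ; apply: filterS (nu_infty N).
pose p g k := sofic_perms (V (nu k)) g k.
have p_mul g h : negl w (fun k => disagree (p (g * h)%g k) (p g k * p h k)%g)
    (fun k => sdim (V (nu k)) k).
  (* Once [nu k] exceeds [q], [f g] and [f h], both elements are controlled at stage [nu k], with an
     error of at most [1/q]. *)
  move=> q; apply: (uf_nu (maxn q (maxn (f g).+1 (f h).+1))) => k.
  rewrite !geq_max => /and3P [qk gk hk]; have [_ + _ _] := Pnu k.
  by move=> /(_ g gk h hk); apply: leq_trans; rewrite leq_mul2l qk orbT.
have p_free g : g != 1%g -> negl w (fun k => #|[set x | p g k x == x]%SET|)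
    (fun k => sdim (V (nu k)) k).
  move=> g1 q; apply: (uf_nu (maxn q (f g).+1)) => k.
  rewrite !geq_max => /andP [qk gk]; have [_ _ + _] := Pnu k.
  by move=> /(_ g gk g1); apply: leq_trans; rewrite leq_mul2l qk orbT.
have n0 k : (0 < sdim (V (nu k)) k)%N by exact: sdim_gt0.
(* This limit is along [\oo], where nothing is known about [nu]; the bound [k <= sdim (V N) k],
   uniform in [N], gives it. *)
have n_infty : sdim (V (nu k)) k @[k --> \oo] --> \oo.
  apply/cvgnyPge => A; exists A => // k /= Ak.
  exact: leq_trans Ak (Vk _ _).
pose W := perm_sofic R n0 n_infty p_mul p_free.
exists W, (fun k => a (nu k) k), (fun k => b (nu k) k), (fun=> 1%N).
split=> //; split.
  rewrite mamp1 model_perm_sofic.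
  exists (fun k => phi (nu k) k) => [k|g]; first exact: phiB.
  move=> q; apply: (uf_nu (maxn q (f g).+1)) => k.
  rewrite !geq_max => /andP [qk gk]; have [+ _ _ _] := Pnu k.
  rewrite /= mcard_amp mcard_model => /(_ g gk); apply: leq_trans.
  by rewrite leq_mul2l qk orbT.
set F := weight R _ _; have FE k : F k = wt (nu k) k.
  by rewrite /F /wt /weight !mcard_amp.
apply/cvgrPdist_lt => e e0; have [q qe] : exists q : nat, e^-1 < q%:R.
  by exists (Num.bound e^-1); apply: archi_boundP; rewrite invr_ge0 ltW.
apply: (uf_nu q) => k qk; rewrite FE distrC; have [_ _ _ h] := Pnu k.
rewrite -(@ltr_pM2l _ q%:R) ?(lt_trans _ qe) ?invr_gt0 //.
apply: (@le_lt_trans _ _ ((nu k)%:R * `|wt (nu k) k - s|)).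
  by rewrite ler_wpM2r // ler_nat.
apply: lt_trans h _; rewrite -(ltr_pM2r e0) ?mul1r in qe *.
by move: qe; rewrite mulVf ?gt_eqF.
Qed.

End Combinations.

(** * Generated faces, minimal faces and extreme points *)

Section Faces.
Variables (R : realType) (w : free_ultrafilter) (G : groupType).
Notation sofic := (sofic_rep R w G).
Implicit Types (X Y Z W T S V : sofic) (l s : R) (F : set (set sofic)).

(** The smallest face through the class of [X], since a face contains the parts of the
    decompositions of its points. *)
Definition generated_face X : set (set sofic) :=
  [set C | exists Y W s, [/\ C = sofic_class Y, 0 < s < 1 & comb s X Y W]].

Lemma conv_comb_reps l (A B C : set sofic) : Sof R w G C -> conv_comb l A B C ->
  exists Y W X, [/\ A = sofic_class Y, B = sofic_class W, C = sofic_class X &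
    comb l X Y W].
Proof.
move=> [X _ <-] XAB; case: (XAB) => Y [W [_ [_ [_ [_ [AY BW _ _]]]]]].
by exists Y, W, X; split=> //; apply/conv_combP; rewrite -AY -BW.
Qed.

Lemma conv_comb_Sof l (A B C : set sofic) : conv_comb l A B C -> Sof R w G C.
Proof.
by case=> Y [W [r [t [r0 [t0 [_ _ _ ->]]]]]]; exists (direct_sum
  (amplification Y r0) (amplification W t0)).
Qed.

Lemma Sof_class X : Sof R w G (sofic_class X).
Proof. by exists X. Qed.

Lemma comb_class l X Y W X' Y' W' : sofic_class X = sofic_class X' ->
  sofic_class Y = sofic_class Y' -> sofic_class W = sofic_class W' ->
  comb l X Y W -> comb l X' Y' W'.
Proof.
by move=> /sofic_classP XX' /sofic_classP YY' /sofic_classP; exact: comb_equiv.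
Qed.

(** Convexity is [comb_convex]. The extremal property is [combA]: parts of a part of [X] are parts
    of [X], with product weights still strictly between 0 and 1. *)
Lemma generated_face_face X : face (generated_face X).
Proof.
split.
- by move=> _ [Y [W [s [-> _ _]]]]; exact: Sof_class.
- exists (sofic_class X), X, X, (1 / 2); split=> //; last exact: comb_half.
  lra.
- move=> l A B C _ [Y [W [s [-> s01 XYW]]]] [Y' [W' [s' [-> s'01 XYW']]]] VYY.
  have [V _ CV] := conv_comb_Sof VYY; move: VYY; rewrite -CV => /conv_combP VYY.
  have [u [U [u01 XVU]]] := comb_convex s01 s'01 XYW XYW' VYY.
  by exists V, U, u.
- move=> l A B C l01 _ _ ABC [Y [W [s [CY s01 XYW]]]].
  have CSof : Sof R w G C by rewrite CY; exact: Sof_class.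
  have [V1 [V2 [Y' [AV BV CY' Y'V]]]] := conv_comb_reps CSof ABC.
  have {}Y'V : comb l Y V1 V2 by apply: comb_class Y'V; rewrite // -CY' CY.
  have [l0 l1] := andP l01; have [s0 s1] := andP s01.
  have [W1 XV1] := combA XYW Y'V; have [W2 XV2] := combA XYW (combC Y'V).
  split.
    exists V1, W1, (s * l); split=> //; nra.
  exists V2, W2, (s * (1 - l)); split=> //; nra.
Qed.

Lemma face_comb F s X Y W : face F -> F (sofic_class X) -> 0 < s < 1 ->
  comb s X Y W -> F (sofic_class Y) /\ F (sofic_class W).
Proof.
move=> [_ _ _ Fface] FX s01 /conv_combP XYW.
by apply: Fface XYW FX => //; exact: Sof_class.
Qed.

Lemma minimal_face_generated F X : minimal_face F -> F (sofic_class X) ->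
  generated_face X = F.
Proof.
move=> [Fface Fmin] FX; have sub : generated_face X `<=` F.
  by move=> _ [Y [W [s [-> s01 XYW]]]]; have [] := face_comb Fface FX s01 XYW.
apply/seteqP; split=> //; apply: contrapT => nsub.
by apply: (Fmin _ (generated_face_face X)).
Qed.

(* The segment from Y through X is prolonged to the last possible point W; if
   W is not X, it lies in F, hence Y occurs in W and the segment goes on past W. *)
Lemma minimal_face_class F X Y : countable [set: G] -> minimal_face F ->
  F (sofic_class X) -> F (sofic_class Y) -> sofic_class X = sofic_class Y.
Proof.
move=> cG Fmin FX FY; have Fface := Fmin.1.
have part Z : F (sofic_class Z) -> exists s W, 0 < s < 1 /\ comb s Z Y W.
  move=> FZ; move: FY; rewrite -{1}(minimal_face_generated Fmin FZ).
  move=> [Y' [W [s [YY' s01 ZYW]]]]; exists s, W; split=> //.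
  exact: comb_class ZYW.
pose A := [set s | exists W, comb s X Y W].
have [s0 [W0 [s001 XYW0]]] := part X FX.
have As0 : A s0 by exists W0.
have A1 : ubound A 1 by move=> s [W /comb_ge0_le1 /andP[]].
have supA : has_sup A by split; [exists s0|exists 1].
have [|W XYW] := @comb_closed R w G (sup A) X Y cG.
  (* The tolerance uses [N.+1] so as to stay positive at [N = 0]. *)
  move=> N; have N0 : 0 < N.+1%:R^-1 :> R by rewrite invr_gt0 ltr0n.
  have [s [W XYW] sA] := sup_adherent N0 supA.
  exists s, W; split=> //.
  have sle : s <= sup A by apply: sup_upper_bound => //; exists W.
  rewrite distrC ger0_norm ?subr_ge0 //.
  have : sup A - s < N.+1%:R^-1 by rewrite ltrBlDr addrC -ltrBlDr.
  rewrite -(@ltr_pM2l _ N.+1%:R) ?ltr0n // divff ?pnatr_eq0 //.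
  by apply: le_lt_trans; rewrite ler_wpM2r ?subr_ge0 // ler_nat.
have [supA1|supA1] := eqVneq (sup A) 1.
  by apply/sofic_classP; apply: (@comb1 R w G X Y W); rewrite -supA1.
have sup1 : sup A < 1 by rewrite lt_neqAle supA1 ge_sup //; exists s0.
have sup0 : 0 < sup A.
  have [s00 _] := andP s001; apply: lt_le_trans s00 _.
  exact: sup_upper_bound.
have [_ FW] : F (sofic_class Y) /\ F (sofic_class W).
  by apply: face_comb Fface FX _ XYW; rewrite sup0 sup1.
have [m [V [/andP[m0 m1] WYV]]] := part W FW.
have : sup A + (1 - sup A) * m <= sup A.
  by apply: sup_upper_bound => //; exists V; exact: comb_line XYW WYV.
by rewrite gerDl leNgt mulr_gt0 // subr_gt0.
Qed.

Lemma extreme_point_face X : extreme_point (sofic_class X) ->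
  face [set sofic_class X].
Proof.
move=> [_ ext]; split.
- by move=> _ ->; exact: Sof_class.
- by exists (sofic_class X).
- move=> l A B C _ -> -> XXZ; have [Z _ CZ] := conv_comb_Sof XXZ.
  move: XXZ; rewrite -CZ => /conv_combP /comb_self ZX.
  exact/sofic_classP.
- by move=> l A B C l01 SA SB ABC CX; apply: (ext l) => //; rewrite -CX.
Qed.

End Faces.

Theorem theorem3p2 (R : realType) (w : free_ultrafilter) (G : groupType)
    (G_countable : countable [set: G])
    (F : set (set (sofic_rep R w G))) (F_sub : F `<=` Sof R w G) :
  minimal_face F <->
  exists2 X : set (sofic_rep R w G), extreme_point X & F = [set X].
Proof.
split=> [Fmin|[X Xext ->]].
  have [Fface _] := Fmin; have [_ [C FC] _ Fext] := Fface.
  have [X _ XC] := F_sub _ FC; rewrite -{}XC in FC.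
  (* Once [F] is a single point, the extremal property of the face [F] is extremality of that
     point. *)
  have FX D : F D -> D = sofic_class X.
    move=> FD; have [Y _ YD] := F_sub _ FD; rewrite -{}YD in FD *.
    exact: minimal_face_class Fmin FD FC.
  exists (sofic_class X); last by apply/seteqP; split=> [D /FX|D ->].
  split=> [|l A B l01 SA SB ABX]; first exact: Sof_class.
  have [FA FB] := Fext l A B _ l01 SA SB ABX FC.
  by split; exact: FX.
have [[T _ TX] _] := Xext; rewrite -{}TX in Xext *.
(* Faces are nonempty, so one inside a singleton is the whole singleton. *)
split=> [|F' [_ [C F'C] _ _] [F'X nXF']]; first exact: extreme_point_face.
by apply: nXF' => _ ->; rewrite -(F'X _ F'C).
Qed.
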